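(* Let $\Bbbk\subseteq\mathbb{C}$ be a subfield stable under complex conjugation, let $V=\Bbbk^n$, and let $G\leq U(n,\Bbbk)$ be a complex reflection group consisting of unitary matrices. Let $f_1,\dots,f_n$ be fundamental invariants of $G$ and let $\Delta\in\Bbbk[V]$ be the Vandermonde of $G$ relative to $f_1,\dots,f_n$. Then the $\det$-isotypic component of $\Bbbk[V]\otimes\Lambda(V)$ has $\Bbbk$-basis \[\{df_{i_1}\cdots df_{i_r}\odot (f_1^{\alpha_1}\cdots f_n^{\alpha_n}\Delta) : \{i_1<\cdots<i_r\}\subseteq\{1,\dots,n\},\ \alpha\in\mathbb{Z}_{\geq 0}^n\}.\]
   Context: $V=\Bbbk^n$ has standard basis $e_1,\dots,e_n$ and $V^*$ has dual basis $x_1,\dots,x_n$; $\Bbbk[V]=\mathrm{Sym}(V^* )=\Bbbk[x_1,\dots,x_n]$. $\Lambda(V^* )$ is the exterior algebra on $V^*$, whose generators corresponding to $x_1,\dots,x_n$ are written $\theta_1,\dots,\theta_n$; $\Lambda(V)$ is the exterior algebra on $V$, with generators $\psi_1,\dots,\psi_n$ corresponding to $e_1,\dots,e_n$. The super-polynomial rings $\Bbbk[V]\otimes\Lambda(V^* )=\Bbbk[x,\theta]$ and $\Bbbk[V]\otimes\Lambda(V)=\Bbbk[x,\psi]$ are the algebras in which the $x_i$ commute with everything and the $\theta_i$ (resp. $\psi_i$) pairwise anticommute. A group $G\leq GL(V)$ acts on $V$ by matrices, on $V^*$ by $(\sigma x)(v)=x(\sigma^{-1}v)$, and on both super-polynomial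 rings by algebra automorphisms, with $\theta_i$ transforming like $x_i$ and $\psi_i$ like $e_i$. A pseudoreflection is a finite-order element of $GL(V)$ whose fixed space has codimension $1$; a complex reflection group is a finite subgroup of $GL(V)$ generated by pseudoreflections. Fundamental invariants are homogeneous algebraically independent $f_1,\dots,f_n$ with $\Bbbk[V]^G=\Bbbk[f_1,\dots,f_n]$. The exterior derivative is the $\Bbbk$-linear map $d(f\theta_I)=\sum_{i=1}^n \frac{\partial f}{\partial x_i}\theta_i\theta_I$ on $\Bbbk[x,\theta]$, where $\theta_I=\theta_{i_1}\cdots\theta_{i_r}$ for $I=\{i_1<\cdots<i_r\}$. The Vandermonde $\Delta\in\Bbbk[V]$ is defined by $df_1\cdots df_n=\Delta\,\theta_1\cdots\theta_n$. Operators on $\Bbbk[x,\psi]$: $\partial_i^x=\partial/\partial x_i$ (extended $\Bbbk[\psi]$-linearly) and $m_i^\psi$ = left multiplication by $\psi_i$ (extended $\Bbbk[x]$-linearly). The action $\odot$ of $\Bbbk[x,\theta]$ on $\Bbbk[x,\psi]$ is $f(x_1,\dots,x_n,\theta_1,\dots,\theta_n)\odot g=\overline{f}(\partial_1^x,\dots,\partial_n^x,m_1^\psi,\dots,m_n^\psi)(g)$, where $\overline{f}$ is $f$ with coefficients complex-conjugated. The $\det$-isotypic component of a $G$-module $M$ is $\{m\in M:\sigma m=\det_V(\sigma)m\ \forall\sigma\in G\}$. *)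

(* Defs.v *)
From HB Require Import structures.
From mathcomp Require Import all_boot all_order all_algebra finmap.
From mathcomp Require Import reals complex.
From mathcomp Require Import ring.
From mathcomp Require Import mpoly.

Set Implicit Arguments.
Unset Strict Implicit.
Unset Printing Implicit Defensive.

Import Order.TTheory GRing.Theory Num.Theory.
Local Open Scope ring_scope.

Section Subfield.
Variables (C : fieldType) (K : divringClosed C).

Record subfield : predArgType := Subfield {
  subfield_val : C;
  subfield_valP : subfield_val \in K }.

HB.instance Definition _ := [isSub for subfield_val].
HB.instance Definition _ := [Choice of subfield by <:].
HB.instance Definition _ := [SubChoice_isSubComUnitRing of subfield by <:].
HB.instance Definition _ :=
  [SubComUnitRing_isSubIntegralDomain of subfield by <:].
HB.instance Definition _ := [SubIntegralDomain_isSubField of subfield by <:].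

End Subfield.

Definition subfield_conj (C : numClosedFieldType) (K : divringClosed C)
    (Kconj : {in K, forall z, z^* \in K}) (x : subfield K) : subfield K :=
  Subfield (Kconj (val x) (valP x)).

(* Model of k[x, t] with t = theta or t = psi: the family u stands for
   \sum_I u I * t_I, where t_I is the product of the generators t_i, i \in I,
   taken in increasing order (see [sp_expand] below).  k[x, theta] and k[x, psi]
   are the same algebra, with theta_i and psi_i both written [sp_gen i]; only
   the actions of GL_n on them differ, and [psi_act] is the one on k[x, psi]. *)
Definition superpoly (n : nat) (k : comNzRingType) :=
  {ffun {set 'I_n} -> {mpoly k[n]}}.

Section SuperPoly.
Variables (n : nat) (k : comNzRingType).

Local Notation SP := (superpoly n k).
Implicit Types (u v w : SP) (I J L : {set 'I_n}) (p q : {mpoly k[n]}).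

HB.instance Definition _ := GRing.Lmodule.copy SP {ffun {set 'I_n} -> {mpoly k[n]}}.

(* For disjoint I and J, t_I * t_J = (-1)^(inversions I J) * t_(I :|: J). *)
Definition inversions I J : nat := \sum_(i in I) \sum_(j in J) (j < i)%N.

Definition sp_one : SP := [ffun I : {set 'I_n} => (I == set0)%:R].

Definition sp_mul u v : SP :=
  [ffun L : {set 'I_n} => \sum_(I : {set 'I_n} | I \subset L)
     (-1) ^+ inversions I (L :\: I) * u I * v (L :\: I)].

Lemma inversions0l J : inversions set0 J = 0%N.
Proof. by rewrite /inversions big_set0. Qed.

Lemma inversions0r I : inversions I set0 = 0%N.
Proof. by rewrite /inversions big1 // => i _; rewrite big_set0. Qed.

Lemma inversionsUl I J L :
  [disjoint I & J] -> inversions (I :|: J) L = (inversions I L + inversions J L)%N.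
Proof.
move=> dIJ; rewrite /inversions (eq_bigl (mem [predU I & J])) ?bigU // => i.
by rewrite !inE.
Qed.

Lemma inversionsUr I J L :
  [disjoint J & L] -> inversions I (J :|: L) = (inversions I J + inversions I L)%N.
Proof.
move=> dJL; rewrite /inversions -big_split; apply: eq_bigr => i _.
by rewrite (eq_bigl (mem [predU J & L])) ?bigU // => j; rewrite !inE.
Qed.

Lemma setUDid I J : I :|: J :\: I = I :|: J.
Proof. by apply/setP => x; rewrite !inE; case: (x \in I). Qed.

Lemma disjointD I J : [disjoint J :\: I & I].
Proof. by rewrite -setI_eq0; apply/eqP/setP => x; rewrite !inE andbAC andNb. Qed.

Lemma sp_mulA : associative sp_mul.
Proof.
move=> u v w; apply/ffunP => L; rewrite !ffunE.
pose F I J := (-1) ^+ (inversions I (J :\: I) + inversions I (L :\: J) +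
  inversions (J :\: I) (L :\: J)) * (u I * v (J :\: I) * w (L :\: J)).
transitivity (\sum_(I : {set 'I_n} | I \subset L)
   \sum_(J : {set 'I_n} | (I \subset J) && (J \subset L)) F I J).
  apply: eq_bigr => I sIL; rewrite ffunE mulr_sumr.
  rewrite (reindex_onto (fun J => J :\: I) (fun J => I :|: J)) /=; last first.
    move=> J sJ; rewrite setDUl setDv set0U; apply/setDidPl.
    by move: sJ; rewrite subsetD => /andP[].
  have eqc J : (J :\: I \subset L :\: I) && (I :|: J :\: I == J)
      = (I \subset J) && (J \subset L).
    rewrite setUDid -(sameP setUidPr eqP) andbC.
    case: (boolP (I \subset J)) => //= sIJ.
    rewrite subsetD subDset (setUidPr sIL) andbC.
    by rewrite disjointD.
  apply: eq_big => [J|J]; first exact: eqc.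
  rewrite eqc /F => /andP[sIJ sJL].
  have -> : (L :\: I) :\: (J :\: I) = L :\: J.
    by rewrite setDDl setUDid (setUidPr sIJ).
  have -> : L :\: I = (J :\: I) :|: (L :\: J).
    apply/setP => x; rewrite !inE.
    have := subsetP sIJ x; have := subsetP sJL x.
    by case: (x \in I) (x \in J) (x \in L) => [] [] [] //= h1 h2;
       rewrite ?(h1 isT) ?(h2 isT) //; move: (h1 isT) (h2 isT).
  rewrite inversionsUr; last first.
    by rewrite disjoint_sym (disjointWr (subsetDl J I)) ?disjointD.
  by rewrite !exprD; ring.
rewrite (exchange_big_dep (fun J : {set 'I_n} => J \subset L)) /=; last first.
  by move=> I J _ /andP[].
apply: eq_bigr => J sJL; rewrite ffunE mulr_sumr mulr_suml.
apply: eq_big => [I|I /andP[sIL /andP[sIJ _]]].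
  rewrite sJL andbT; case: (boolP (I \subset J)) => [sIJ|]; rewrite ?andbF //.
  by rewrite (subset_trans sIJ sJL).
have -> : inversions J (L :\: J) =
    (inversions I (L :\: J) + inversions (J :\: I) (L :\: J))%N.
  rewrite -inversionsUl 1?disjoint_sym ?disjointD //.
  by rewrite setUDid (setUidPr sIJ).
rewrite /F.
by rewrite !exprD; ring.
Qed.

Lemma sp_mul1l : left_id sp_one sp_mul.
Proof.
move=> u; apply/ffunP => L; rewrite ffunE (bigD1 set0) ?sub0set //=.
rewrite big1 ?addr0 => [|I /andP[_ /negPf nI]]; last first.
  by rewrite ffunE nI mulr0 mul0r.
by rewrite ffunE eqxx inversions0l mul1r setD0 mul1r.
Qed.

Lemma sp_mul1r : right_id sp_one sp_mul.
Proof.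
move=> u; apply/ffunP => L; rewrite ffunE (bigD1 L) //=.
rewrite big1 ?addr0 => [|I /andP[sI nI]]; last first.
  rewrite ffunE setD_eq0; case: (boolP (L \subset I)) => sL; last by rewrite mulr0.
  by case/negP: nI; rewrite eqEsubset sI.
by rewrite ffunE setDv eqxx inversions0r mul1r mulr1.
Qed.

Lemma sp_mulDl : left_distributive sp_mul +%R.
Proof.
move=> u v w; apply/ffunP => L; rewrite !ffunE -big_split /=.
by apply: eq_bigr => I _; rewrite ffunE mulrDr mulrDl.
Qed.

Lemma sp_mulDr : right_distributive sp_mul +%R.
Proof.
move=> u v w; apply/ffunP => L; rewrite !ffunE -big_split /=.
by apply: eq_bigr => I _; rewrite ffunE mulrDr.
Qed.

Lemma sp_one_neq0 : sp_one != 0.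
Proof.
apply/eqP => /ffunP/(_ set0); rewrite !ffunE eqxx => /eqP.
by rewrite oner_eq0.
Qed.

HB.instance Definition _ := GRing.Zmodule_isNzRing.Build SP
  sp_mulA sp_mul1l sp_mul1r sp_mulDl sp_mulDr sp_one_neq0.

Lemma sp_scaleAl (c : k) u v : c *: (u * v) = (c *: u) * v.
Proof.
apply/ffunP => L; rewrite !ffunE scaler_sumr; apply: eq_bigr => I _.
by rewrite ffunE -scalerAr scalerAl.
Qed.

Lemma sp_scaleAr (c : k) u v : c *: (u * v) = u * (c *: v).
Proof.
apply/ffunP => L; rewrite !ffunE scaler_sumr; apply: eq_bigr => I _.
by rewrite ffunE scalerAr.
Qed.

HB.instance Definition _ := GRing.Lmodule_isLalgebra.Build k SP sp_scaleAl.
HB.instance Definition _ := GRing.Lalgebra_isAlgebra.Build k SP sp_scaleAr.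

Definition sp_poly p : SP := [ffun I : {set 'I_n} => if I == set0 then p else 0].

Definition sp_gen (i : 'I_n) : SP := [ffun I : {set 'I_n} => (I == [set i])%:R].

Lemma sp_polyM p u I : (sp_poly p * u) I = p * u I.
Proof.
rewrite ffunE (bigD1 set0) ?sub0set //=.
rewrite big1 ?addr0 => [|J /andP[_ /negPf nJ]]; last first.
  by rewrite ffunE nJ mulr0 mul0r.
by rewrite ffunE eqxx inversions0l mul1r setD0.
Qed.

Lemma sp_poly_comm p u : GRing.comm (sp_poly p) u.
Proof.
apply/ffunP => I; rewrite sp_polyM ffunE (bigD1 I) //=.
rewrite big1 ?addr0 => [|J /andP[sJ nJ]]; last first.
  rewrite ffunE setD_eq0; case: (boolP (I \subset J)) => sI; last by rewrite mulr0.
  by case/negP: nJ; rewrite eqEsubset sJ.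
by rewrite ffunE setDv eqxx inversions0r mul1r mulrC.
Qed.

Lemma sp_genE i u I :
  (sp_gen i * u) I =
  if i \in I then (-1) ^+ inversions [set i] (I :\ i) * u (I :\ i) else 0.
Proof.
rewrite ffunE; case: ifP => iI.
  rewrite (bigD1 [set i]) ?sub1set //= big1 ?addr0 => [|J /andP[_ /negPf nJ]].
    by rewrite ffunE eqxx mulr1.
  by rewrite ffunE nJ mulr0 mul0r.
rewrite big1 // => J sJ; rewrite ffunE; case: eqP => [eJ|_]; last by rewrite mulr0 mul0r.
by move: sJ; rewrite eJ sub1set iI.
Qed.

Lemma sp_gen_sqr i : sp_gen i * sp_gen i = 0.
Proof.
apply/ffunP => I; rewrite sp_genE !ffunE; case: ifP => // iI.
case: eqP => [/setP/(_ i)|_]; last by rewrite mulr0.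
by rewrite !inE eqxx.
Qed.

Lemma inversions11 i j : inversions [set i] [set j] = (j < i)%N.
Proof. by rewrite /inversions !big_set1. Qed.

Lemma sp_gen_anti i j : sp_gen i * sp_gen j = - (sp_gen j * sp_gen i).
Proof.
have [->|nij] := eqVneq i j; first by rewrite sp_gen_sqr oppr0.
have E a b I : a != b ->
    (sp_gen a * sp_gen b) I = if I == [set a; b] then (-1) ^+ (b < a)%N else 0.
  move=> nab; rewrite sp_genE ffunE.
  case: (I =P [set a; b]) => [->|nI].
    rewrite !inE eqxx /=.
    have -> : [set a; b] :\ a = [set b].
      by rewrite setU1K ?inE //.
    by rewrite eqxx mulr1 inversions11.
  case: ifP => // aI; case: eqP => [eI|_]; last by rewrite mulr0.
  by case: nI; rewrite -(setD1K aI) eI.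
apply/ffunP => I; rewrite [RHS]ffunE E // E; last by rewrite eq_sym.
rewrite setUC.
case: eqP => _; last by rewrite oppr0.
by case: (ltngtP i j) nij => [||/val_inj ->]; rewrite ?expr1 ?opprK ?eqxx.
Qed.

Lemma sp_prod_gen I :
  \prod_(i in I) sp_gen i = [ffun J : {set 'I_n} => (J == I)%:R].
Proof.
have E (r : seq 'I_n) : sorted (fun i j : 'I_n => i < j)%N r ->
    \prod_(i <- r) sp_gen i = [ffun J : {set 'I_n} => (J == [set x in r])%:R].
  elim: r => [|i r IHr] srt.
    rewrite big_nil; apply/ffunP => J; rewrite !ffunE.
    by congr ((J == _)%:R); apply/setP => x; rewrite !inE.
  rewrite big_cons IHr ?(path_sorted srt) //.
  have lt_i j : j \in r -> (i < j)%N.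
    move=> jr; apply: (allP (order_path_min _ srt)) jr.
    by move=> x y z; apply: ltn_trans.
  have nir : i \notin r by apply/negP => /lt_i; rewrite ltnn.
  apply/ffunP => J; rewrite sp_genE !ffunE.
  have -> : [set x in i :: r] = i |: [set x in r].
    by apply/setP => x; rewrite !inE.
  case: ifP => iJ.
    case: (J :\ i =P [set x in r]) => [eJ|neJ].
      rewrite -eJ setD1K // eqxx mulr1 eJ /inversions big_set1 big1 // => j.
      by rewrite inE => /lt_i ltij; rewrite ltnNge ltnW.
    rewrite mulr0; case: eqP => // eJ; case: neJ.
    by rewrite eJ setU1K // inE.
  by case: eqP iJ => // ->; rewrite !inE eqxx.
rewrite -big_filter E.
  apply/ffunP => J; rewrite !ffunE; congr ((J == _)%:R).
  by apply/setP => x; rewrite inE mem_filter mem_index_enum andbT.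
rewrite [index_enum _]unlock -enumT; apply: sorted_filter.
  by move=> x y z; apply: ltn_trans.
have := iota_ltn_sorted 0 n; rewrite -val_enum_ord sorted_map; exact.
Qed.

Lemma sp_expand u : u = \sum_I sp_poly (u I) * \prod_(i in I) sp_gen i.
Proof.
apply/ffunP => J; rewrite sum_ffunE (bigD1 J) //= sp_polyM sp_prod_gen ffunE eqxx.
rewrite mulr1 big1 ?addr0 // => I nIJ.
by rewrite sp_polyM sp_prod_gen ffunE eq_sym (negPf nIJ) mulr0.
Qed.

(* The exterior derivative d (p t_I) = \sum_i (dp/dx_i) t_i t_I. *)
Definition sp_d u : SP :=
  \sum_(I : {set 'I_n}) \sum_(i < n)
    sp_poly (u I)^`M(i) * (sp_gen i * \prod_(j in I) sp_gen j).

(* The iterated partial derivative of multi-index m, applied coordinatewise. *)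
Definition sp_derivm (m : 'X_{1..n}) u : SP := [ffun I : {set 'I_n} => (u I)^`M[m]].

(* f (.) g : in f, coefficients are conjugated by [cj], the x_i are replaced by
   d/dx_i, and the generators by left multiplication by the generators. *)
Definition odot (cj : k -> k) (f g : SP) : SP :=
  \sum_(I : {set 'I_n}) \sum_(m <- msupp (f I))
    cj ((f I)@_m) *: sp_derivm m (foldr (fun i h => sp_gen i * h) g (enum I)).

End SuperPoly.

Section ReflectionGroups.
Variables (n : nat) (k : fieldType).
Implicit Types (s : 'M[k]_n) (p : {mpoly k[n]}) (f : n.-tuple {mpoly k[n]}).

Definition subgroupGL (H : {pred 'M[k]_n}) : Prop :=
  [/\ {in H, forall s, s \in unitmx},
      1%:M \in H,
      {in H &, forall s t, s *m t \in H}
    & {in H, forall s, invmx s \in H}].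

(* Matrices act on column vectors. *)
Definition pseudoreflection s : Prop :=
  [/\ s \in unitmx,
      exists2 m, (0 < m)%N & s ^+ m = 1
    & (\dim (fixedSpace (linfun (mulmx s : 'cV_n -> 'cV_n)))).+1 = n].

Definition generated_by (G S : {pred 'M[k]_n}) : Prop :=
  {subset S <= G} /\
  forall H : {pred 'M[k]_n},
    subgroupGL H -> {subset S <= H} -> {subset G <= H}.

Definition complex_reflection_group (G : {fset 'M[k]_n}) : Prop :=
  subgroupGL (mem G) /\
  exists2 S : {fset 'M[k]_n},
    {in S, forall s, pseudoreflection s} & generated_by (mem G) (mem S).

(* From (s x)(v) = x (s^-1 v): x_i |-> \sum_j (s^-1)_ij x_j. *)
Definition poly_act s p : {mpoly k[n]} :=
  p \mPo [tuple \sum_(j < n) invmx s i j *: 'X_j | i < n].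

(* psi_i transforms like e_i: psi_i |-> \sum_j s_ji psi_j. *)
Definition psi_act s (u : superpoly n k) : superpoly n k :=
  \sum_(I : {set 'I_n})
    sp_poly (poly_act s (u I)) * \prod_(i in I) \sum_(j < n) s j i *: sp_gen k j.

Definition fundamental_invariants (G : {fset 'M[k]_n}) f : Prop :=
  [/\ forall i, exists d, tnth f i \is d.-homog,
      forall q : {mpoly k[n]}, q \mPo f = 0 -> q = 0
    & forall p, {in G, forall s, poly_act s p = p} <->
                exists q : {mpoly k[n]}, p = q \mPo f].

Definition vandermonde f (Delta : {mpoly k[n]}) : Prop :=
  \prod_(i < n) sp_d (sp_poly (tnth f i)) =
  sp_poly Delta * \prod_(i < n) sp_gen k i.

Definition det_isotypic (G : {fset 'M[k]_n}) (u : superpoly n k) : Prop :=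
  {in G, forall s, psi_act s u = \det s *: u}.

End ReflectionGroups.

(* The (possibly infinite) family b is a basis of the subspace W. *)
Definition basis_family (k : fieldType) (M : lmodType k) (T : eqType)
    (W : M -> Prop) (b : T -> M) : Prop :=
  [/\ forall t, W (b t),
      forall (r : seq T) (c : T -> k),
        uniq r -> \sum_(t <- r) c t *: b t = 0 -> {in r, forall t, c t = 0}
    & forall w, W w ->
        exists (r : seq T) (c : T -> k), w = \sum_(t <- r) c t *: b t].

(* Main.v *)
(* Write <p, q> = (conj(p)(d/dx) q)(0), a positive definite form for which the
   operator conj(r)(d/dx) is adjoint to multiplication by r, and let
   b(I, a) = df_I (.) (f^a Delta).

   Independence.  By Laplace expansion, applying signed complementary minors of
   the Jacobian matrix to sum c(I, a) b(I, a) = 0 isolates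
   conj(Delta)(d/dx) (h Delta) = 0 with h = sum_a c(I, a) f^a, hence
   <h Delta, h Delta> = 0 and h = 0.

   Spanning.  In bounded degree, subtract from a det-isotypic w its orthogonal
   projection on the span of the b(I, a).  For the residue w', the polynomial
   sum_J (df_I)_J w'_J is a det-semi-invariant, so it is g Delta with g invariant;
   it is orthogonal to every f^a Delta, so it vanishes, and w' = 0 because the
   minors (df_I)_J form an invertible matrix.

   Divisibility of a det-semi-invariant p by Delta.  On a generic line, a point v
   has a stabiliser consisting of reflections in one hyperplane, cyclic of order e
   say.  There p vanishes to order at least e - 1, while Delta vanishes to order at
   most e - 1: averaging over G yields invariants agreeing with those of the
   stabiliser to high order at v, and these are polynomials in f.  So Delta
   divides p on generic lines, hence everywhere. *)
From HB Require Import structures.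
Require Import Defs.
From mathcomp Require Import all_boot all_order all_algebra all_fingroup finmap.
From mathcomp Require Import reals complex.
From mathcomp Require boolp.
From mathcomp Require Import ssrcomplements mpoly.
From mathcomp Require Import ring zify.

Set Implicit Arguments.
Unset Strict Implicit.
Unset Printing Implicit Defensive.

Import Order.TTheory GRing.Theory Num.Theory.
Local Open Scope ring_scope.

(** * Exterior algebra *)

(** On a line over [k] the restriction of Delta may have its roots outside [k], so orders of
    vanishing are compared over the algebraically closed [C], while the line itself must be chosen
    over [k], before the roots are known. This is possible because the stabiliser of any point over
    [C] is a subset of the finite group: the finitely many matrices [1 - average], all with entries
    in [k], carry every genericity condition. As [average] is the projection on the fixed space,
    that the stabiliser fixes a hyperplane takes the form that [1 - average] has rank at most 1. The
    nonvanishing of Delta comes from the same local comparison, made at a point with trivial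
    stabiliser. Divisibility passes from lines to [k[x]] because, for Delta homogeneous with
    Delta(b) nonzero, Delta(x + T b) has a constant leading coefficient in T, so that division with
    remainder by it is available over [k[x]]. Unitarity is what makes the conjugation in the action
    on [k[x, psi]] equivariant: the conjugate of s^-1 is the transpose of s, so a conjugated x_i
    transforms like d/dx_i, and a conjugated theta_i like psi_i. *)

Section OrderedProducts.
Variables (n : nat) (A : nzRingType).
Implicit Types (y : 'I_n -> A) (I J K : {set 'I_n}).

Lemma enum_set_sorted K : sorted (fun i j : 'I_n => i < j)%N (enum K).
Proof.
rewrite /enum_mem -enumT; apply: sorted_filter; first by move=> x y z; apply: ltn_trans.
by have := iota_ltn_sorted 0 n; rewrite -val_enum_ord sorted_map.
Qed.

Lemma set_minP K : K != set0 -> exists2 i, i \in K & {in K, forall j : 'I_n, (i <= j)%N}.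
Proof.
case/set0Pn => x xK.
by exists [arg min_(i < x in K) val i]; case: arg_minnP.
Qed.

Lemma prod_set_enum y K : \prod_(j in K) y j = \prod_(j <- enum K) y j.
Proof. by rewrite -big_filter [index_enum _]unlock. Qed.

Lemma prod_set_min y K i : i \in K -> {in K, forall j : 'I_n, (i <= j)%N} ->
  \prod_(j in K) y j = y i * \prod_(j in K :\ i) y j.
Proof.
move=> iK min_i; rewrite !prod_set_enum -(big_cons _ _ _ _ xpredT y).
congr (\big[_/_]_(j <- _) _).
have tr : transitive (fun i j : 'I_n => i < j)%N by move=> a b c; apply: ltn_trans.
apply: (irr_sorted_eq tr) => [j||| j].
- by rewrite ltnn.
- exact: enum_set_sorted.
- have /= := enum_set_sorted (K :\ i).
  rewrite (path_sortedE tr) => ->; rewrite andbT; apply/allP => j.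
  rewrite mem_enum !inE => /andP[nji jK]; rewrite ltn_neqAle min_i // andbT.
  by rewrite eq_sym -(inj_eq val_inj) in nji.
- by rewrite inE !mem_enum !inE; case: eqP => // ->.
Qed.

Lemma set_min_ind (P : {set 'I_n} -> Prop) : P set0 ->
  (forall K i, i \in K -> {in K, forall j : 'I_n, (i <= j)%N} -> P (K :\ i) -> P K) ->
  forall K, P K.
Proof.
move=> P0 PS K; elim/ltn_ind: #|K| {-2}K (erefl #|K|) => {K} m IH K cK.
have [->//|nK] := eqVneq K set0.
have [i iK min_i] := set_minP nK.
apply: (PS _ i) => //; apply: (IH #|K :\ i|) => //.
by rewrite -cK [in X in (_ < X)%N](cardsD1 i) iK.
Qed.

Lemma inversions_min (i : 'I_n) K :
  {in K, forall j : 'I_n, (i <= j)%N} -> inversions [set i] K = 0%N.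
Proof.
move=> min_i; rewrite /inversions big_set1 big1 // => j /min_i; rewrite leqNgt.
by case: ltnP.
Qed.

(** Vanishing squares are a separate clause, since in characteristic 2 they do not follow from
    anticommutation. *)
Definition anticommuting y :=
  (forall i j, y i * y j = - (y j * y i)) /\ (forall i, y i * y i = 0).

Variables (y : 'I_n -> A) (hy : anticommuting y).

(** Bringing [y i] to its place in the increasing product passes the members of [K] below [i];
    [inversions [set i] K] counts them. *)
Lemma mul_prod_set1 i K : y i * \prod_(j in K) y j =
  if i \in K then 0 else (-1) ^+ inversions [set i] K * \prod_(j in i |: K) y j.
Proof.
have [anti sqr] := hy.
elim/set_min_ind: K => [|K k kK min_k IH].
  by rewrite !inE inversions0r expr0 mul1r setU0 !big_set0 big_set1 mulr1.
rewrite (prod_set_min _ kK min_k) mulrA.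
have [->|nik] := eqVneq i k; first by rewrite kK sqr mul0r.
have [lti|leki] := ltnP i k.
  have niK : i \notin K by apply/negP => /min_k; rewrite leqNgt lti.
  rewrite (negPf niK) inversions_min => [|j /min_k lekj]; last first.
    exact: leq_trans (ltnW lti) _.
  rewrite expr0 mul1r [RHS](@prod_set_min _ _ i) ?setU11 //.
    rewrite setU1K // -mulrA; congr (_ * _).
    by rewrite -prod_set_min.
  move=> j; rewrite !inE => /predU1P[->//|/min_k]; apply: leq_trans.
  exact: ltnW.
have ltki : (k < i)%N.
  by rewrite ltn_neqAle leki andbT; apply: contra nik => /eqP/val_inj ->.
rewrite anti mulNr -mulrA IH !inE (negPf nik) /=.
case: ifP => iK; first by rewrite mulr0 oppr0.
rewrite [X in _ = _ * X](@prod_set_min _ _ k) ?inE ?kK ?orbT //; last first.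
  by move=> j; rewrite !inE => /predU1P[->|/min_k].
have -> : (i |: K) :\ k = i |: K :\ k.
  apply/setP => j; rewrite !inE; case: (eqVneq j k) => [->|//].
  by rewrite eq_sym (negPf nik).
have -> : inversions [set i] K = (inversions [set i] (K :\ k)).+1.
  rewrite -{1}(setD1K kK) inversionsUr ?inversions11 ?ltki //.
  by rewrite disjoints1 !inE eqxx.
by rewrite exprS mulN1r mulNr !mulrA commr_sign.
Qed.

Lemma mul_prod_set I K : \prod_(j in I) y j * \prod_(j in K) y j =
  if [disjoint I & K] then (-1) ^+ inversions I K * \prod_(j in I :|: K) y j else 0.
Proof.
elim/set_min_ind: I => [|I i iI min_i IH].
  by rewrite big_set0 mul1r -setI_eq0 set0I eqxx inversions0l expr0 mul1r set0U.
rewrite (prod_set_min _ iI min_i) -mulrA IH.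
have disjE : [disjoint I & K] = (i \notin K) && [disjoint I :\ i & K].
  by rewrite -setI_eq0 -{1}(setD1K iI) setIUl setU_eq0 !setI_eq0 disjoints1.
rewrite disjE; case: ifP => dIK; last by rewrite andbF mulr0.
rewrite andbT mulrA commr_sign -mulrA mul_prod_set1 !inE eqxx /=.
case: (boolP (i \in K)) => iK; first by rewrite mulr0.
rewrite mulrA -exprD setUA setD1K //; congr ((-1) ^+ _ * _).
have dI : [disjoint [set i] & I :\ i] by rewrite disjoints1 !inE eqxx.
rewrite -[in RHS](setD1K iI) inversionsUl // addnC inversionsUr //.
by rewrite [inversions _ (_ :\ _)]inversions_min // => j; rewrite !inE => /andP[_ /min_i].
Qed.

End OrderedProducts.

Section SignedProducts.
Variables (n : nat) (A : nzRingType).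
Implicit Types (y : 'I_n -> A).

Lemma anticommuting_comp y (g : 'I_n -> 'I_n) : anticommuting y -> anticommuting (y \o g).
Proof. by case=> anti sqr; split=> [i j|i] /=; [exact: anti | exact: sqr]. Qed.

(** With the factors [a] and [b] in front, exchanging them moves no other factor. The sign does not
    depend on the family [y], so the formula can be compared for [y] and for [y \o tperm a b]. *)
Lemma prod_pairE y (a b : 'I_n) : anticommuting y -> a != b ->
  \prod_i y i = (-1) ^+ ((b < a)%N + inversions [set a; b] (~: [set a; b])) *
    (y a * y b * \prod_(i in ~: [set a; b]) y i).
Proof.
move=> hy nab; have := mul_prod_set1 hy a [set b].
rewrite inE (negPf nab) big_set1 inversions11 => ->.
rewrite -mulrA mul_prod_set // -setI_eq0 setICr eqxx setUCr.
rewrite !mulrA -!exprD -addnA addnn -mul2n exprM sqrrN !expr1n mul1r.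
by apply: eq_bigl => i; rewrite inE.
Qed.

Lemma prod_tperm y (a b : 'I_n) : anticommuting y -> a != b ->
  \prod_i y (tperm a b i) = - \prod_i y i.
Proof.
move=> hy nab; have hy' := anticommuting_comp (tperm a b) hy.
rewrite [LHS](prod_pairE hy' nab) [in RHS](prod_pairE hy nab) /= tpermL tpermR.
rewrite (proj1 hy b a) mulNr mulrN; congr (- (_ * (_ * _))).
apply: eq_bigr => i; rewrite !inE negb_or => /andP[nia nib].
by rewrite tpermD // eq_sym.
Qed.

Lemma prod_perm y (s : 'S_n) : anticommuting y ->
  \prod_i y (s i) = (-1) ^+ s * \prod_i y i.
Proof.
case: (prod_tpermP s) => ts -> {s}; elim: ts y => [|[a b] ts IH] y /= dts hy.
  rewrite big_nil odd_perm1 mul1r; apply: eq_bigr => i _; by rewrite perm1.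
case/andP: dts => nab dts; rewrite big_cons odd_mul_tperm nab /=.
under eq_bigr => i _ do rewrite permM.
rewrite (prod_tperm (anticommuting_comp _ hy) nab) /= IH //.
by rewrite signrN mulNr.
Qed.

Lemma prod_anticommuting_eq0 y (a b : 'I_n) : anticommuting y -> a != b -> y a = y b ->
  \prod_i y i = 0.
Proof. by move=> hy nab eab; rewrite (prod_pairE hy nab) eab (proj2 hy) mul0r mulr0. Qed.

End SignedProducts.

Section SuperPolyLemmas.
Variables (n : nat) (k : comNzRingType).
Local Notation SP := (superpoly n k).
Implicit Types (u v w : SP) (y : 'I_n -> SP) (p q : {mpoly k[n]}).

Fact sp_poly_is_additive : additive (@sp_poly n k).
Proof.
by move=> p q; apply/ffunP => I; rewrite !ffunE; case: ifP; rewrite ?subr0.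
Qed.

HB.instance Definition _ := GRing.isZmodMorphism.Build {mpoly k[n]} SP (@sp_poly n k)
  sp_poly_is_additive.

Fact sp_poly_is_multiplicative : multiplicative (@sp_poly n k).
Proof.
split=> [p q|]; apply/ffunP => I; rewrite ?sp_polyM !ffunE.
  by case: ifP; rewrite ?mulr0.
by case: eqP.
Qed.

HB.instance Definition _ := GRing.isMonoidMorphism.Build {mpoly k[n]} SP (@sp_poly n k)
  (sp_poly_is_multiplicative.2, sp_poly_is_multiplicative.1).

Lemma sp_polyZ (c : k) u : c *: u = sp_poly c%:MP * u.
Proof. by apply/ffunP => I; rewrite sp_polyM ffunE mul_mpolyC. Qed.

Lemma prod_gen_top : (\prod_i sp_gen k i) setT = 1 :> {mpoly k[n]}.
Proof.
have -> : \prod_i sp_gen k i = \prod_(i in [set: 'I_n]) sp_gen k i :> SP.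
  by apply: eq_bigl => i; rewrite inE.
by rewrite sp_prod_gen ffunE eqxx.
Qed.

Lemma anticommuting_gen : anticommuting (@sp_gen n k).
Proof. by split=> [i j|i]; [exact: sp_gen_anti | exact: sp_gen_sqr]. Qed.

Lemma anticommuting_lin (B : 'M[{mpoly k[n]}]_n) y : anticommuting y ->
  anticommuting (fun i => \sum_j sp_poly (B i j) * y j).
Proof.
move=> hy.
have E i j : (\sum_l sp_poly (B i l) * y l) * (\sum_l sp_poly (B j l) * y l) =
    \sum_l \sum_m sp_poly (B i l * B j m) * (y l * y m).
  rewrite mulr_suml; apply: eq_bigr => l _; rewrite mulr_sumr; apply: eq_bigr => m _.
  by rewrite -mulrA [y l * _]mulrA -[y l * _]sp_poly_comm rmorphM !mulrA.
split=> [i j|i].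
  rewrite !E exchange_big -sumrN; apply: eq_bigr => l _; rewrite -sumrN.
  by apply: eq_bigr => m _; rewrite (proj1 hy) mulrN mulrC.
rewrite E.
pose F (l m : 'I_n) := sp_poly (B i l * B i m) * (y l * y m).
have FN l m : F l m = - F m l by rewrite /F (proj1 hy) mulrN mulrC.
have F0 l : F l l = 0 by rewrite /F (proj2 hy) mulr0.
rewrite -/(\sum_l \sum_m F l m).
(* The square vanishes without dividing by 2: the terms with [l < m] cancel those with [m < l]. *)
have split_sum : \sum_l \sum_m F l m =
    (\sum_(l : 'I_n) \sum_(m : 'I_n | (l < m)%N) F l m) +
    (\sum_(l : 'I_n) \sum_(m : 'I_n | (m < l)%N) F l m).
  rewrite -big_split; apply: eq_bigr => l _ /=.
  rewrite (bigD1 l) //= F0 add0r (bigID (fun m : 'I_n => (l < m)%N)) /=.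
  congr (_ + _); apply: eq_bigl => m; rewrite -(inj_eq val_inj) /=; lia.
rewrite split_sum [X in _ + X](exchange_big_dep xpredT) //= -big_split /=.
apply: big1 => l _; rewrite -big_split /=; apply: big1 => m _.
by rewrite FN addNr.
Qed.

(** In the expanded product a choice of columns that is not injective repeats a factor and vanishes;
    sorting the factors of an injective choice gives the sign of the permutation. *)
Lemma prod_lin (B : 'M[{mpoly k[n]}]_n) y : anticommuting y ->
  \prod_i (\sum_j sp_poly (B i j) * y j) = sp_poly (\det B) * \prod_i y i.
Proof.
move=> hy; rewrite bigA_distr_bigA /=.
have split_prod (g : 'I_n -> 'I_n) : \prod_i (sp_poly (B i (g i)) * y (g i)) =
    sp_poly (\prod_i B i (g i)) * \prod_i y (g i).
  elim/big_rec3: _ => [|i a q c _ ->]; first by rewrite rmorph1 mul1r.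
  by rewrite rmorphM -!mulrA; congr (_ * _); rewrite !mulrA -[y (g i) * sp_poly q]sp_poly_comm.
rewrite (bigID (fun f : {ffun 'I_n -> 'I_n} => injectiveb f)) /= addrC big1 ?add0r.
  rewrite (reindex (@pval _)) /=; last first.
    pose in_Sn := insubd (1%g : 'S_n).
    by exists in_Sn => /= f Uf; first apply: val_inj; apply: insubdK.
  rewrite /determinant rmorph_sum mulr_suml.
  apply: eq_big => /= [s | s _]; first by rewrite ?(valP s).
  rewrite split_prod.
  have -> : \prod_i y (pval s i) = \prod_i y (s i) by apply: eq_bigr => i _; rewrite pvalE.
  rewrite prod_perm // rmorphM rmorphXn rmorphN1 mulrA; congr (_ * _).
  rewrite commr_sign; congr (_ * sp_poly _); by apply: eq_bigr => i _; rewrite pvalE.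
move=> f /injectivePn[a [b nab eab]].
rewrite split_prod (prod_anticommuting_eq0 (anticommuting_comp f hy) nab) ?mulr0 //=.
by rewrite eab.
Qed.

End SuperPolyLemmas.

Section Substitution.
Variables (n : nat) (k : comNzRingType).
Local Notation SP := (superpoly n k).
Implicit Types (u v w : SP) (y : 'I_n -> SP) (p q : {mpoly k[n]}) (I J K L : {set 'I_n}).
Implicit Types (tau : {rmorphism {mpoly k[n]} -> {mpoly k[n]}}).

(** Both group actions and all coefficientwise ring morphisms ([sp_subst_coord]) are instances, so
    multiplicativity is proved once, for any anticommuting [y]. *)
Definition sp_subst (tau : {mpoly k[n]} -> {mpoly k[n]}) y u : SP :=
  \sum_(I : {set 'I_n}) sp_poly (tau (u I)) * \prod_(i in I) y i.

Lemma sp_substM tau y : anticommuting y -> {morph sp_subst tau y : u v / u * v}.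
Proof.
move=> hy u v; rewrite /sp_subst mulr_suml.
pose F I K : SP := sp_poly (tau (u I) * tau (v K)) * (\prod_(i in I) y i * \prod_(i in K) y i).
transitivity (\sum_I \sum_K F I K); last first.
  apply: eq_bigr => I _; rewrite mulr_sumr; apply: eq_bigr => K _.
  by rewrite /F rmorphM -!mulrA; congr (_ * _); rewrite !mulrA; congr (_ * _); exact: sp_poly_comm.
transitivity (\sum_(L : {set 'I_n}) \sum_(I : {set 'I_n} | I \subset L) F I (L :\: I)).
  apply: eq_bigr => L _; rewrite ffunE rmorph_sum rmorph_sum mulr_suml.
  apply: eq_bigr => I sIL; rewrite /F mul_prod_set // disjoint_sym disjointD.
  rewrite setUDid (setUidPr sIL) !rmorphM !rmorphXn !rmorphN1 /=.
  by rewrite !mulrA; congr (_ * _); rewrite -mulrA commr_sign.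
rewrite (exchange_big_dep xpredT) //=; apply: eq_bigr => I _.
rewrite [RHS](bigID (fun K => [disjoint I & K])) /= [X in _ = _ + X]big1 ?addr0; last first.
  by move=> K /negPf dIK; rewrite /F mul_prod_set // dIK mulr0.
rewrite (reindex_onto (fun K => I :|: K) (fun L => L :\: I)) /=; last first.
  by move=> L sIL; rewrite setUDid (setUidPr sIL).
apply: eq_big => K; rewrite subsetUl /= setDUl setDv set0U.
  by rewrite -setI_eq0 setIC setI_eq0; apply/eqP/idP => /setDidPl.
by move/eqP=> ->.
Qed.

Lemma sp_subst_is_additive tau y : additive (sp_subst tau y).
Proof.
move=> u v; rewrite /sp_subst -sumrB; apply: eq_bigr => I _.
by rewrite !ffunE !rmorphB mulrBl.
Qed.

Lemma sp_subst_poly tau y p : sp_subst tau y (sp_poly p) = sp_poly (tau p).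
Proof.
rewrite /sp_subst (bigD1 set0) //= [X in _ + X]big1 => [|I /negPf nI].
  by rewrite ffunE eqxx big_set0 mulr1 addr0.
by rewrite ffunE nI !rmorph0 mul0r.
Qed.

Lemma sp_subst_gen tau y i : sp_subst tau y (sp_gen k i) = y i.
Proof.
rewrite /sp_subst (bigD1 [set i]) //= [X in _ + X]big1 => [|I /negPf nI].
  by rewrite ffunE eqxx big_set1 !rmorph1 mul1r addr0.
by rewrite ffunE nI !rmorph0 mul0r.
Qed.

Lemma sp_subst_sum tau y (T : Type) (r : seq T) (P : pred T) (F : T -> SP) :
  sp_subst tau y (\sum_(i <- r | P i) F i) = \sum_(i <- r | P i) sp_subst tau y (F i).
Proof.
have s0 : sp_subst tau y 0 = 0.
  by have := sp_subst_is_additive tau y 0 0; rewrite !subrr.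
have sD : {morph sp_subst tau y : u v / u + v}.
  move=> u v; have := sp_subst_is_additive tau y (u + v) v; rewrite addrK => ->.
  by rewrite subrK.
by rewrite (big_morph _ sD s0).
Qed.

Lemma sp_subst_prod tau y (T : Type) (r : seq T) (P : pred T) (F : T -> SP) : anticommuting y ->
  sp_subst tau y (\prod_(i <- r | P i) F i) = \prod_(i <- r | P i) sp_subst tau y (F i).
Proof.
move=> hy; have s1 : sp_subst tau y 1 = 1.
  by have := sp_subst_poly tau y 1; rewrite !rmorph1.
by rewrite (big_morph _ (sp_substM tau hy) s1).
Qed.

Lemma sp_subst_coord tau u J : sp_subst tau (@sp_gen n k) u J = tau (u J).
Proof.
rewrite /sp_subst sum_ffunE (bigD1 J) //= [X in _ + X]big1 => [|I nI].
  by rewrite sp_polyM sp_prod_gen ffunE eqxx mulr1 addr0.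
by rewrite sp_polyM sp_prod_gen ffunE eq_sym (negPf nI) mulr0.
Qed.

Lemma sp_subst_lin tau y (a : 'I_n -> {mpoly k[n]}) : anticommuting y ->
  sp_subst tau y (\sum_j sp_poly (a j) * sp_gen k j) = \sum_j sp_poly (tau (a j)) * y j.
Proof.
move=> hy; rewrite sp_subst_sum; apply: eq_bigr => j _.
by rewrite sp_substM // sp_subst_poly sp_subst_gen.
Qed.

End Substitution.

(** * The pairing of k[x, theta] with k[x, psi], and interior products *)

Section Contraction.
Variables (n : nat) (k : comNzRingType).
Local Notation SP := (superpoly n k).
Implicit Types (u v w : SP) (y : 'I_n -> SP) (p q : {mpoly k[n]}) (I J K L : {set 'I_n}).
Implicit Types (a b : 'I_n -> {mpoly k[n]}).

(** The [k[x]]-bilinear pairing for which the theta_I and the psi_I are dual bases. *)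
Definition sp_dot u w : {mpoly k[n]} := \sum_J u J * w J.

Definition sp_linear a : SP := \sum_j sp_poly (a j) * sp_gen k j.

(** The interior product: the adjoint under [sp_dot] of left multiplication by [sp_gen k j], as
    [sp_dot_gen] shows. *)
Definition contract_gen (j : 'I_n) w : SP :=
  [ffun J : {set 'I_n} => if j \in J then 0 else (-1) ^+ inversions [set j] J * w (j |: J)].

Definition contract a w : SP := \sum_j sp_poly (a j) * contract_gen j w.

Lemma sp_oneE J : (1 : SP) J = (J == set0)%:R.
Proof. by rewrite -[1]/(sp_one n k) ffunE. Qed.

Lemma sp_dotDl u v w : sp_dot (u + v) w = sp_dot u w + sp_dot v w.
Proof. by rewrite /sp_dot -big_split; apply: eq_bigr => J _; rewrite ffunE mulrDl. Qed.

Lemma sp_dotDr u v w : sp_dot u (v + w) = sp_dot u v + sp_dot u w.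
Proof. by rewrite /sp_dot -big_split; apply: eq_bigr => J _; rewrite ffunE mulrDr. Qed.

Lemma sp_dot_suml (T : Type) (r : seq T) (P : pred T) (F : T -> SP) w :
  sp_dot (\sum_(i <- r | P i) F i) w = \sum_(i <- r | P i) sp_dot (F i) w.
Proof.
have s0 : sp_dot 0 w = 0 by rewrite /sp_dot big1 // => J _; rewrite ffunE mul0r.
by rewrite (big_morph (fun u => sp_dot u w) (fun u v => sp_dotDl u v w) s0).
Qed.

Lemma sp_dot_sumr (T : Type) (r : seq T) (P : pred T) (F : T -> SP) u :
  sp_dot u (\sum_(i <- r | P i) F i) = \sum_(i <- r | P i) sp_dot u (F i).
Proof.
have s0 : sp_dot u 0 = 0 by rewrite /sp_dot big1 // => J _; rewrite ffunE mulr0.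
by rewrite (big_morph (sp_dot u) (sp_dotDr u) s0).
Qed.

Lemma sp_dot_polyl p u w : sp_dot (sp_poly p * u) w = p * sp_dot u w.
Proof. by rewrite /sp_dot mulr_sumr; apply: eq_bigr => J _; rewrite sp_polyM mulrA. Qed.

Lemma sp_dot_polyr p u w : sp_dot u (sp_poly p * w) = p * sp_dot u w.
Proof. by rewrite /sp_dot mulr_sumr; apply: eq_bigr => J _; rewrite sp_polyM mulrCA. Qed.

Lemma sp_dot_gen j u w : sp_dot (sp_gen k j * u) w = sp_dot u (contract_gen j w).
Proof.
rewrite /sp_dot (bigID (fun J => j \in J)) /= [X in _ + X]big1 ?addr0; last first.
  by move=> J /negPf nJ; rewrite sp_genE nJ mul0r.
rewrite [RHS](bigID (fun J => j \in J)) /= [X in _ = X + _]big1 ?add0r; last first.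
  by move=> J jJ; rewrite ffunE jJ mulr0.
rewrite (reindex_onto (fun J => j |: J) (fun J => J :\ j)) /=; last first.
  by move=> J jJ; rewrite setD1K.
apply: eq_big => J; rewrite setU11 /=.
  apply/eqP/idP => [<-|njJ]; first by rewrite !inE eqxx.
  by rewrite setU1K.
move/eqP => eJ; have njJ : j \notin J by rewrite -eJ !inE eqxx.
by rewrite sp_genE setU11 ffunE (negPf njJ) eJ [RHS]mulrCA mulrA.
Qed.

Lemma sp_dot_linear a u w : sp_dot (sp_linear a * u) w = sp_dot u (contract a w).
Proof.
rewrite /sp_linear mulr_suml sp_dot_suml sp_dot_sumr; apply: eq_bigr => j _.
by rewrite -mulrA sp_dot_polyl sp_dot_gen sp_dot_polyr.
Qed.

Lemma contract_gen_gen j l w :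
  contract_gen j (sp_gen k l * w) = w *+ (j == l) - sp_gen k l * contract_gen j w.
Proof.
have sgn2 (m : nat) : (-1) ^+ m * (-1) ^+ m = 1 :> {mpoly k[n]}.
  by rewrite -exprD addnn -mul2n exprM sqrrN !expr1n.
apply/ffunP => J; rewrite ffunE [RHS]ffunE [X in _ = _ + X]ffunE !sp_genE !ffunE.
rewrite mulrb.
have [->|njl] := eqVneq j l.
  have [lJ|nlJ] := boolP (l \in J).
    by rewrite !inE eqxx /= setD1K // mulrA sgn2 mul1r subrr.
  by rewrite setU11 setU1K // mulrA sgn2 mul1r subr0.
rewrite ffunE sub0r !inE njl eq_sym (negPf njl) /=.
have [jJ|njJ] := boolP (j \in J); first by rewrite mulr0 if_same oppr0.
have [lJ|nlJ] := boolP (l \in J); last by rewrite mulr0 oppr0.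
have -> : (j |: J) :\ l = j |: J :\ l.
  apply/setP => x; rewrite !inE; case: (eqVneq x l) => [->|//].
  by rewrite eq_sym (negPf njl).
have -> : inversions [set j] J = ((l < j)%N + inversions [set j] (J :\ l))%N.
  by rewrite -{1}(setD1K lJ) inversionsUr ?inversions11 // disjoints1 !inE eqxx.
have -> : inversions [set l] (j |: J :\ l) = ((j < l)%N + inversions [set l] (J :\ l))%N.
  by rewrite inversionsUr ?inversions11 // disjoints1 !inE (negPf njJ) andbF.
rewrite !exprD; case: (ltngtP j l) njl => [||/val_inj ->]; rewrite ?eqxx // => _ _;
  rewrite !expr0 !expr1; ring.
Qed.

Lemma contract_is_zmod_morphism a : zmod_morphism (contract a).
Proof.
move=> u v; rewrite /contract -sumrB; apply: eq_bigr => j _.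
rewrite -mulrBr; congr (_ * _); apply/ffunP => J; rewrite !ffunE.
by case: ifP => _; rewrite ?subr0 // mulrBr.
Qed.

HB.instance Definition _ a := GRing.isZmodMorphism.Build SP SP (contract a)
  (contract_is_zmod_morphism a).

Lemma contract_poly a p w : contract a (sp_poly p * w) = sp_poly p * contract a w.
Proof.
rewrite /contract mulr_sumr; apply: eq_bigr => j _.
rewrite mulrA -rmorphM mulrC rmorphM -mulrA; congr (_ * _).
apply/ffunP => J; rewrite sp_polyM ffunE [in RHS]ffunE sp_polyM.
by case: ifP => _; rewrite ?mulr0 // mulrCA.
Qed.

(** The Clifford relation between contraction and left multiplication, extended from
    [contract_gen_gen] by linearity over [k[x]]. *)
Lemma contract_linear a b w :
  contract a (sp_linear b * w) = sp_poly (\sum_j a j * b j) * w - sp_linear b * contract a w.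
Proof.
rewrite {1}/sp_linear mulr_suml raddf_sum /=.
under eq_bigr => l _ do rewrite -mulrA contract_poly.
rewrite /contract; under eq_bigr => l _ do rewrite mulr_sumr.
have E l j : sp_poly (b l) * (sp_poly (a j) * contract_gen j (sp_gen k l * w)) =
    sp_poly (a j * b l) * (w *+ (j == l)) -
    sp_poly (b l) * sp_gen k l * (sp_poly (a j) * contract_gen j w).
  rewrite contract_gen_gen mulrA -rmorphM mulrBr [b l * _]mulrC; congr (_ - _).
  rewrite rmorphM [X in X * _](sp_poly_comm (a j) (sp_poly (b l))) -!mulrA; congr (_ * _).
  by rewrite !mulrA; congr (_ * _); exact: sp_poly_comm.
under eq_bigr => l _ do under eq_bigr => j _ do rewrite E.
under eq_bigr => l _ do rewrite sumrB.
rewrite sumrB; congr (_ - _).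
  rewrite rmorph_sum mulr_suml; apply: eq_bigr => l _.
  rewrite (bigD1 l) //= eqxx big1 ?addr0 // => j /negPf nj.
  by rewrite nj mulr0.
rewrite /sp_linear mulr_suml; apply: eq_bigr => l _; by rewrite mulr_sumr.
Qed.

Section Dual.
Variables (a b : 'I_n -> 'I_n -> {mpoly k[n]}).
Hypothesis dual_ab : forall i j, \sum_l a i l * b j l = (i == j)%:R.

Lemma sp_linear_anticommuting (c : 'I_n -> 'I_n -> {mpoly k[n]}) :
  anticommuting (fun i => sp_linear (c i)).
Proof.
have := anticommuting_lin (\matrix_(i, j) c i j) (@anticommuting_gen n k).
have E i : \sum_l sp_poly ((\matrix_(i, j) c i j) i l) * sp_gen k l = sp_linear (c i).
  by apply: eq_bigr => l _; rewrite mxE.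
case=> anti sqr; split=> [i j|i]; rewrite -!E; [exact: anti | exact: sqr].
Qed.

Lemma contract_prod i K : contract (a i) (\prod_(j in K) sp_linear (b j)) =
  if i \in K then (-1) ^+ inversions [set i] (K :\ i) * \prod_(j in K :\ i) sp_linear (b j)
  else 0.
Proof.
have c1 : contract (a i) 1 = 0.
  rewrite /contract big1 // => j _; apply/ffunP => J; rewrite sp_polyM !ffunE.
  case: ifP => _; rewrite ?mulr0 //.
  by case: eqP => [/setP/(_ j)|_]; rewrite ?mulr0 // !inE eqxx.
elim/set_min_ind: K => [|K x xK min_x IH]; first by rewrite inE big_set0.
rewrite (prod_set_min _ xK min_x) contract_linear IH dual_ab !inE.
have [->|nix] := eqVneq i x.
  rewrite xK /= rmorph1 mul1r mulr0 subr0 inversions_min ?mul1r //.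
  by move=> j; rewrite !inE => /andP[_ /min_x].
rewrite rmorph0 mul0r sub0r /=; case: ifP => iK; last by rewrite mulr0 oppr0.
have xK' : x \in K :\ i by rewrite !inE eq_sym nix.
rewrite [\prod_(j in K :\ i) _](@prod_set_min _ _ _ _ x) //; last first.
  by move=> j; rewrite !inE => /andP[_ /min_x].
have -> : K :\ x :\ i = K :\ i :\ x by apply/setP => y; rewrite !inE andbCA.
have -> : inversions [set i] (K :\ i) = (inversions [set i] (K :\ i :\ x)).+1.
  rewrite -{1}(setD1K xK') inversionsUr ?inversions11.
    have -> // : (x < i)%N.
    rewrite ltn_neqAle min_x // andbT eq_sym.
    by apply: contra nix => /eqP/val_inj ->.
  by rewrite disjoints1 !inE eqxx.
by rewrite exprS mulN1r mulNr !mulrA commr_sign.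
Qed.

(** Exterior powers of dual families are dual. The least index of [J] is moved to the other side as
    a contraction, which deletes it from [K]; this avoids the Cauchy-Binet formula. *)
Lemma sp_dot_dual J K :
  sp_dot (\prod_(i in J) sp_linear (a i)) (\prod_(i in K) sp_linear (b i)) = (J == K)%:R.
Proof.
elim/set_min_ind: J K => [|J i iJ min_i IH] K.
  rewrite big_set0 /sp_dot (bigD1 set0) //= [X in _ + X]big1 => [|I /negPf nI]; last first.
    by rewrite sp_oneE nI mul0r.
  rewrite sp_oneE eqxx mul1r addr0 eq_sym.
  have [->|nK] := eqVneq K set0; first by rewrite big_set0 sp_oneE eqxx.
  have [x xK min_x] := set_minP nK; rewrite (prod_set_min _ xK min_x).
  rewrite [sp_linear (b x)]/sp_linear mulr_suml sum_ffunE big1 // => j _.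
  by rewrite -mulrA sp_polyM sp_genE inE mulr0.
rewrite (prod_set_min _ iJ min_i) sp_dot_linear contract_prod.
case: ifP => iK; last first.
  rewrite /sp_dot big1 => [|L _]; last by rewrite ffunE mulr0.
  by case: eqP iK => // <-; rewrite iJ.
have -> : (-1) ^+ inversions [set i] (K :\ i) = sp_poly ((-1) ^+ inversions [set i] (K :\ i)) :> SP.
  by rewrite rmorphXn rmorphN1.
rewrite sp_dot_polyr IH.
have -> : (J :\ i == K :\ i) = (J == K).
  apply/eqP/eqP => [e|->//]; by rewrite -(setD1K iJ) e setD1K.
case: eqP => [<-|_]; last by rewrite mulr0.
by rewrite inversions_min ?mul1r // => j; rewrite !inE => /andP[_ /min_i].
Qed.

End Dual.

End Contraction.

(** * Minors and the Laplace expansion *)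

Section Minors.
Variables (n : nat) (k : comNzRingType).
Local Notation SP := (superpoly n k).
Implicit Types (u v w : SP) (p q : {mpoly k[n]}) (I J K L : {set 'I_n}).
Variable (c : 'I_n -> 'I_n -> {mpoly k[n]}).
Local Notation y := (fun i => sp_linear (c i)).

Lemma prod_linear_supp L J : #|J| != #|L| -> (\prod_(i in L) sp_linear (c i)) J = 0.
Proof.
elim/set_min_ind: L J => [|L i iL min_i IH] J.
  by rewrite cards0 big_set0 sp_oneE cards_eq0 => /negPf->.
rewrite (cardsD1 i L) iL => nJ; rewrite (prod_set_min _ iL min_i).
rewrite /sp_linear mulr_suml sum_ffunE big1 // => j _.
rewrite -mulrA sp_polyM sp_genE; case: ifP => jJ; last by rewrite mulr0.
rewrite -/(sp_linear _) IH ?mulr0 //.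
by apply: contraNneq nJ => <-; rewrite (cardsD1 j) jJ.
Qed.

Lemma prod_linear_top : (\prod_i sp_linear (c i)) setT = \det (\matrix_(i, j) c i j).
Proof.
have E i : \sum_l sp_poly ((\matrix_(i, j) c i j) i l) * sp_gen k l = sp_linear (c i).
  by apply: eq_bigr => l _; rewrite mxE.
rewrite -(eq_bigr _ (fun i _ => E i)) prod_lin ?sp_polyM; last exact: anticommuting_gen.
by rewrite prod_gen_top mulr1.
Qed.

(** The coordinate [J] of the product over [I] is the minor of [c] with rows [I] and columns [J];
    this is its cofactor in the Laplace expansion along the rows [I]. *)
Definition comp_minor I J : {mpoly k[n]} :=
  (-1) ^+ inversions I (~: I) * ((-1) ^+ inversions J (~: J) *
    (\prod_(i in ~: I) sp_linear (c i)) (~: J)).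

(** The sum is, up to sign, the top coordinate of the product over [I] times the product over
    [~: K]. If [I] and [K] differ, either a factor repeats or [I] is a proper subset of [K] and the
    degree is too small. *)
Lemma laplace_expansion I K :
  \sum_J (\prod_(i in I) sp_linear (c i)) J * comp_minor K J =
  (I == K)%:R * \det (\matrix_(i, j) c i j).
Proof.
pose P L := \prod_(i in L) sp_linear (c i).
have E : (P I * P (~: K)) setT =
    \sum_J (-1) ^+ inversions J (~: J) * P I J * P (~: K) (~: J).
  rewrite ffunE; apply: eq_big => [J|J _]; first by rewrite subsetT.
  by rewrite setTD.
transitivity ((-1) ^+ inversions K (~: K) * (P I * P (~: K)) setT).
  rewrite E mulr_sumr; apply: eq_bigr => J _; rewrite /comp_minor -!/(P _).
  by rewrite mulrCA; congr (_ * _); rewrite mulrCA mulrA.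
rewrite mul_prod_set; last exact: sp_linear_anticommuting.
have [->|nIK] := eqVneq I K.
  rewrite -setI_eq0 setICr eqxx.
  rewrite setUCr.
  have -> : (-1) ^+ inversions K (~: K) = sp_poly ((-1) ^+ inversions K (~: K)) :> SP.
    by rewrite rmorphXn rmorphN1.
  rewrite sp_polyM mulrA -exprD addnn -mul2n exprM sqrrN !expr1n !mul1r.
  rewrite -prod_linear_top; congr ((_ : SP) _); by apply: eq_bigl => i; rewrite inE.
rewrite mul0r; case: ifP => dIK; last by rewrite ffunE mulr0.
have -> : (-1) ^+ inversions I (~: K) = sp_poly ((-1) ^+ inversions I (~: K)) :> SP.
  by rewrite rmorphXn rmorphN1.
rewrite sp_polyM prod_linear_supp ?mulr0 // cardsT card_ord.
have sIK : I \subset K by rewrite -(setCK K) -disjoints_subset.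
apply: contra nIK => /eqP cU; rewrite eqEsubset sIK /=.
have eT : I :|: ~: K = setT by apply/eqP; rewrite eqEcard subsetT cardsT card_ord {1}cU leqnn.
by apply/subsetP => x xK; have := in_setT x; rewrite -eT !inE xK orbF.
Qed.

End Minors.

(** The minors of all orders form one square matrix [M] indexed by subsets. Its product with the
    matrix [F] of cofactors is the scalar [D], so [det M] is nonzero. *)
Lemma sp_dot_prod_inj n (k : fieldType) (c : 'I_n -> 'I_n -> {mpoly k[n]}) (w : superpoly n k) :
  \det (\matrix_(i, j) c i j) != 0 ->
  (forall I : {set 'I_n}, sp_dot (\prod_(i in I) sp_linear (c i)) w = 0) -> w = 0.
Proof.
move=> nz_det w_orth; set D := \det _ in nz_det.
pose N := #|{set 'I_n}|; pose e (a : 'I_N) : {set 'I_n} := enum_val a.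
pose M : 'M_N := \matrix_(a, b) (\prod_(i in e a) sp_linear (c i)) (e b).
pose F : 'M_N := \matrix_(a, b) comp_minor c (e b) (e a).
have MF : M *m F = D%:M.
  apply/matrixP => a b; rewrite !mxE.
  transitivity (\sum_J (\prod_(i in e a) sp_linear (c i)) J * comp_minor c (e b) J).
    rewrite [RHS](reindex e) /=; last by apply: onW_bij; exact: enum_val_bij.
    by apply: eq_bigr => x _; rewrite !mxE.
  by rewrite laplace_expansion (inj_eq enum_val_inj) mulrb; case: eqP; rewrite ?mul1r ?mul0r.
have nzM : \det M != 0.
  have : \det (M *m F) != 0 by rewrite MF det_scalar expf_neq0.
  by rewrite det_mulmx mulf_eq0 negb_or => /andP[].
pose W : 'cV_N := \col_a w (e a).
have MW : M *m W = 0.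
  apply/matrixP => a b; rewrite !mxE; apply: etrans (w_orth (e a)); rewrite /sp_dot.
  rewrite [RHS](reindex e) /=; last by apply: onW_bij; exact: enum_val_bij.
  by apply: eq_bigr => x _; rewrite !mxE.
have : \det M *: W = 0 by rewrite -mul_scalar_mx -mul_adj_mx -mulmxA MW mulmx0.
move/matrixP => W0; apply/ffunP => J; rewrite [RHS]ffunE.
have := W0 (enum_rank J) 0; rewrite !mxE /e enum_rankK => /eqP.
by rewrite mulf_eq0 (negPf nzM) => /eqP.
Qed.

Lemma mpoly_gen_ind n (k : comNzRingType) (P : {mpoly k[n]} -> Prop) :
  (forall c, P c%:MP) -> (forall i, P 'X_i) ->
  (forall p q, P p -> P q -> P (p + q)) -> (forall p q, P p -> P q -> P (p * q)) ->
  forall p, P p.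
Proof.
move=> PC PX PD PM p; rewrite (mpolyE p); apply: big_ind => [||a _].
- by rewrite -mpolyC0.
- exact: PD.
rewrite -mul_mpolyC; apply: (PM); first exact: PC.
rewrite mpolyXE_id; apply: big_ind => [||i _]; [by rewrite -mpolyC1|exact: PM|].
by elim: (a i) => [|d IHd]; rewrite ?expr0 -?mpolyC1 ?exprS //; apply: (PM).
Qed.

Lemma mderivXU n (k : comNzRingType) (i j : 'I_n) : ('X_i : {mpoly k[n]})^`M(j) = (i == j)%:R.
Proof.
rewrite mderivX mnm1E; case: eqP => [->|_]; last by rewrite scale0r.
rewrite scale1r; have -> : (U_(j) - U_(j))%MM = 0%MM :> 'X_{1..n}.
  by apply/mnmP => x; rewrite mnmBE subnn mnm0E.
by rewrite mpolyX0.
Qed.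

Section Derivations.
Variables (n : nat) (k : comNzRingType).
Implicit Types (p q : {mpoly k[n]}).

Lemma mderiv_comp m (q : {mpoly k[m]}) (lq : m.-tuple {mpoly k[n]}) j :
  (q \mPo lq)^`M(j) = \sum_l (q^`M(l) \mPo lq) * (tnth lq l)^`M(j).
Proof.
elim/mpoly_gen_ind: q => [c|i|p q IHp IHq|p q IHp IHq].
- by rewrite comp_mpolyC mderivC big1 // => l _; rewrite mderivC comp_mpoly0 mul0r.
- rewrite comp_mpolyXU -tnth_nth (bigD1 i) //= big1 => [|l nl].
    by rewrite mderivXU eqxx rmorph1 mul1r addr0.
  by rewrite mderivXU eq_sym (negPf nl) rmorph0 mul0r.
- rewrite rmorphD mderivD IHp IHq -big_split; apply: eq_bigr => l _ /=.
  by rewrite mderivD rmorphD mulrDl.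
rewrite rmorphM mderivM IHp IHq mulr_suml mulr_sumr -big_split; apply: eq_bigr => l _ /=.
by rewrite mderivM rmorphD !rmorphM /=; ring.
Qed.

Lemma sp_d_poly p : sp_d (sp_poly p) = sp_linear (fun j => p^`M(j)).
Proof.
rewrite /sp_d (bigD1 set0) //= [X in _ + X]big1 ?addr0 => [|I /negPf nI]; last first.
  by rewrite big1 // => i _; rewrite ffunE nI mderiv0 rmorph0 mul0r.
by apply: eq_bigr => i _; rewrite ffunE eqxx big_set0 mulr1.
Qed.

End Derivations.

(** * Polynomial differential operators and the Fischer inner product *)

Section DiffOp.
Variables (n : nat) (k : comNzRingType) (cj : {rmorphism k -> k}).
Implicit Types (p q r h : {mpoly k[n]}) (m : 'X_{1..n}).

Definition diff_op r h : {mpoly k[n]} := \sum_(m <- msupp r) cj r@_m *: h^`M[m].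

(** A common degree bound replaces the support, so that operators of several polynomials are sums
    over one index set. *)
Lemma diff_opE r h B : (msize r <= B)%N ->
  diff_op r h = \sum_(m : 'X_{1..n < B}) cj r@_m *: h^`M[m].
Proof.
move=> leB; pose I : subFinType _ := 'X_{1..n < B}.
rewrite /diff_op (big_mksub I) //=; first last.
- by move=> x /msize_mdeg_lt /leq_trans; apply.
- by rewrite msupp_uniq.
rewrite big_rmcond //= => m /memN_msupp_eq0 ->.
by rewrite rmorph0 scale0r.
Qed.

Lemma diff_op_is_zmod_morphism_r r : zmod_morphism (diff_op r).
Proof.
move=> p q; rewrite /diff_op -sumrB; apply: eq_bigr => m _.
by rewrite raddfB scalerBr.
Qed.

HB.instance Definition _ r := GRing.isZmodMorphism.Build {mpoly k[n]} {mpoly k[n]} (diff_op r)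
  (diff_op_is_zmod_morphism_r r).

Lemma diff_opZr r c h : diff_op r (c *: h) = c *: diff_op r h.
Proof.
rewrite /diff_op scaler_sumr; apply: eq_bigr => m _.
by rewrite mderivmZ !scalerA mulrC.
Qed.

Lemma diff_opDl p q h : diff_op (p + q) h = diff_op p h + diff_op q h.
Proof.
pose B := maxn (msize (p + q)) (maxn (msize p) (msize q)).
rewrite !(@diff_opE _ _ B) ?leq_max ?leqnn ?orbT // -big_split; apply: eq_bigr => m _.
by rewrite mcoeffD rmorphD scalerDl.
Qed.

Lemma diff_op0l h : diff_op 0 h = 0.
Proof. by rewrite /diff_op msupp0 big_nil. Qed.

Lemma diff_opZl c p h : diff_op (c *: p) h = cj c *: diff_op p h.
Proof.
rewrite !(@diff_opE _ _ (msize p)) ?msizeZ_le // scaler_sumr; apply: eq_bigr => m _.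
by rewrite mcoeffZ rmorphM scalerA.
Qed.

Lemma diff_op_suml (T : Type) (r : seq T) (P : pred T) (F : T -> {mpoly k[n]}) h :
  diff_op (\sum_(i <- r | P i) F i) h = \sum_(i <- r | P i) diff_op (F i) h.
Proof.
by rewrite (big_morph (fun p => diff_op p h) (fun p q => diff_opDl p q h) (diff_op0l h)).
Qed.

Lemma diff_opX m h : diff_op 'X_[m] h = h^`M[m].
Proof. by rewrite /diff_op msuppX big_seq1 mcoeffX eqxx rmorph1 scale1r. Qed.

Lemma diff_opM p q h : diff_op (p * q) h = diff_op p (diff_op q h).
Proof.
rewrite {1}(mpolyE p) mulr_suml diff_op_suml {2}/diff_op; apply: eq_bigr => m _.
rewrite -scalerAl diff_opZl; congr (_ *: _).
rewrite {1}(mpolyE q) mulr_sumr diff_op_suml {2}/diff_op raddf_sum; apply: eq_bigr => m' _ /=.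
by rewrite -scalerAr diff_opZl -mpolyXD diff_opX mderivmZ addmC mderivmDm.
Qed.

End DiffOp.

Section Pairing.
Variables (n : nat) (k : comNzRingType) (cj : {rmorphism k -> k}).
Hypothesis cjK : involutive cj.
(** Positive definiteness expressed without an order on [k]; the weights [c] will be the factorials
    in [fischerE]. *)
Hypothesis posdef : forall (T : finType) (x : T -> k) (c : T -> nat),
  (forall t, 0 < c t)%N -> \sum_t cj (x t) * x t *+ c t = 0 -> forall t, x t = 0.
Implicit Types (p q r h : {mpoly k[n]}) (m : 'X_{1..n}).

(* Monomials are orthogonal and <x^m, x^m> = m!. *)
Definition fischer p q : k := (diff_op cj p q)@_0%MM.

Lemma fischerE p q B : (msize p <= B)%N ->
  fischer p q = \sum_(m : 'X_{1..n < B}) cj p@_m * q@_m *+ \prod_i (m i)`!.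
Proof.
move=> leB; rewrite /fischer (diff_opE _ _ leB) raddf_sum; apply: eq_bigr => m _ /=.
rewrite mcoeffZ mcoeff_mderivm addm0 mulrnAr; congr (_ *+ _).
by apply: eq_bigr => i _; rewrite ffactnn.
Qed.

Lemma fischer_adj p q r : fischer p (diff_op cj r q) = fischer (r * p) q.
Proof. by rewrite /fischer mulrC diff_opM. Qed.

Lemma fischerC p q : fischer p q = cj (fischer q p).
Proof.
pose B := maxn (msize p) (msize q).
rewrite !(@fischerE _ _ B) ?leq_max ?leqnn ?orbT // rmorph_sum; apply: eq_bigr => m _.
by rewrite rmorphMn rmorphM cjK mulrC.
Qed.

Lemma fischer_eq0 p : fischer p p = 0 -> p = 0.
Proof.
rewrite (@fischerE _ _ (msize p)) // => /posdef p0.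
apply/mpolyP => m; rewrite mcoeff0.
have [ltm|gem] := ltnP (mdeg m) (msize p); last by rewrite memN_msupp_eq0 ?msize_mdeg_ge.
apply: (p0 _ (BMultinom ltm)) => t; apply: prodn_gt0 => i; exact: fact_gt0.
Qed.

Lemma fischerDr p q r : fischer p (q + r) = fischer p q + fischer p r.
Proof. by rewrite /fischer raddfD mcoeffD. Qed.

Lemma fischerZr c p q : fischer p (c *: q) = c * fischer p q.
Proof. by rewrite /fischer diff_opZr mcoeffZ. Qed.

Lemma fischer_sumr p (T : Type) (r : seq T) (P : pred T) (F : T -> {mpoly k[n]}) :
  fischer p (\sum_(i <- r | P i) F i) = \sum_(i <- r | P i) fischer p (F i).
Proof.
have F0 : fischer p 0 = 0 by rewrite /fischer raddf0 mcoeff0.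
exact: (big_morph (fischer p) (fischerDr p) F0).
Qed.

Lemma diff_op_inj p h : diff_op cj p (h * p) = 0 -> h * p = 0.
Proof.
move=> e; apply: fischer_eq0; rewrite mulrC -fischer_adj.
by rewrite [p * h]mulrC e /fischer raddf0 mcoeff0.
Qed.

Definition sp_fischer (u v : superpoly n k) : k := \sum_J fischer (u J) (v J).

Lemma sp_fischerDr u v w : sp_fischer u (v + w) = sp_fischer u v + sp_fischer u w.
Proof.
by rewrite /sp_fischer -big_split; apply: eq_bigr => J _; rewrite ffunE fischerDr.
Qed.

Lemma sp_fischerZr c u v : sp_fischer u (c *: v) = c * sp_fischer u v.
Proof.
by rewrite /sp_fischer mulr_sumr; apply: eq_bigr => J _; rewrite ffunE fischerZr.
Qed.

Lemma sp_fischerC u v : sp_fischer u v = cj (sp_fischer v u).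
Proof. by rewrite /sp_fischer rmorph_sum; apply: eq_bigr => J _; apply: fischerC. Qed.

End Pairing.

(** * Orthogonal projection on a finite span *)

Section GramSchmidt.
Variables (n : nat) (k : fieldType) (cj : {rmorphism k -> k}).
Hypothesis cjK : involutive cj.
Hypothesis posdef : forall (T : finType) (x : T -> k) (c : T -> nat),
  (forall t, 0 < c t)%N -> \sum_t cj (x t) * x t *+ c t = 0 -> forall t, x t = 0.
Implicit Types (u v w : superpoly n k).

Lemma sp_fischer_eq0 u : sp_fischer cj u u = 0 -> u = 0.
Proof.
pose B := (\max_J msize (u J))%N.
have leB J : (msize (u J) <= B)%N by exact: leq_bigmax.
rewrite /sp_fischer; under eq_bigr => J _ do rewrite (fischerE _ _ (leB J)).
rewrite pair_bigA => /posdef u0.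
apply/ffunP => J; rewrite ffunE; apply/mpolyP => m; rewrite mcoeff0.
have [ltm|gem] := ltnP (mdeg m) B.
  by apply: (u0 _ (J, BMultinom ltm)) => t; apply: prodn_gt0 => i; exact: fact_gt0.
by rewrite memN_msupp_eq0 ?msize_mdeg_ge // (leq_trans (leB J)).
Qed.

(** Gram-Schmidt by induction on the list: the induction hypothesis gives residues of both [b t0]
    and [w] with respect to [r], and the residue of [w] is then corrected along that of [b t0]. The
    family may be dependent. *)
Lemma orthogonal_residue (T : eqType) (b : T -> superpoly n k) (r : seq T) w : uniq r ->
  exists c : T -> k,
    {in r, forall t, sp_fischer cj (b t) (w - \sum_(s <- r) c s *: b s) = 0}.
Proof.
elim: r w => [|t0 r IHr] w /=; first by exists (fun=> 0).
case/andP=> t0r ur.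
have [c1 orth1] := IHr (b t0) ur; have [c2 orth2] := IHr w ur.
set b' := b t0 - _ in orth1; set w' := w - _ in orth2.
pose d := sp_fischer cj b' w' / sp_fischer cj b' b'.
exists (fun s => if s == t0 then d else c2 s - d * c1 s).
have -> : w - \sum_(s <- t0 :: r) (if s == t0 then d else c2 s - d * c1 s) *: b s = w' - d *: b'.
  rewrite big_cons eqxx.
  have -> : \sum_(s <- r) (if s == t0 then d else c2 s - d * c1 s) *: b s =
      \sum_(s <- r) c2 s *: b s - d *: \sum_(s <- r) c1 s *: b s.
    rewrite scaler_sumr -sumrB; apply: eq_big_seq => s sr.
    case: eqP => [es|_]; first by rewrite -es sr in t0r.
    by rewrite scalerBl scalerA.
  rewrite /w' /b' scalerBr !opprD !opprK !addrA; congr (_ + _).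
  by rewrite addrAC.
have FrB u v c : sp_fischer cj u (v - c *: b') = sp_fischer cj u v - c * sp_fischer cj u b'.
  by rewrite sp_fischerDr -scaleNr sp_fischerZr mulNr.
have orthr t : t \in r -> sp_fischer cj (b t) (w' - d *: b') = 0.
  by move=> tr; rewrite FrB orth1 // orth2 // mulr0 subrr.
move=> t; rewrite inE => /predU1P[->|]; last exact: orthr.
have -> : b t0 = b' + \sum_(s <- r) c1 s *: b s by rewrite subrK.
rewrite sp_fischerC // sp_fischerDr.
have -> : sp_fischer cj (w' - d *: b') (\sum_(s <- r) c1 s *: b s) = 0.
  have F0 u : sp_fischer cj u 0 = 0.
    by rewrite -(scale0r (0 : superpoly n k)) sp_fischerZr mul0r.
  rewrite (big_morph _ (sp_fischerDr cj _) (F0 _)).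
  rewrite big1_seq // => s /andP[_ sr].
  by rewrite sp_fischerZr sp_fischerC // orthr // rmorph0 mulr0.
rewrite addr0 -sp_fischerC // FrB /d.
(* When [b t0] lies in the span of the others, [b'] is 0 by definiteness and the value of [d] does
   not matter. *)
have [b0|nb0] := eqVneq (sp_fischer cj b' b') 0; last by rewrite divfK // subrr.
rewrite b0 mulr0 subr0 (sp_fischer_eq0 b0) sp_fischerC //.
by rewrite -(scale0r (0 : superpoly n k)) sp_fischerZr mul0r rmorph0.
Qed.

End GramSchmidt.

(** * Group actions *)

Section Action.
Variables (n : nat) (k : fieldType).
Local Notation SP := (superpoly n k).
Implicit Types (u v w : SP) (p q h : {mpoly k[n]}) (s : 'M[k]_n).

HB.instance Definition _ s := GRing.LRMorphism.copy (poly_act s)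
  (comp_mpoly [tuple \sum_(j < n) invmx s i j *: 'X_j | i < n]).

Lemma poly_actXU s i : poly_act s 'X_i = \sum_(j < n) invmx s i j *: 'X_j.
Proof. by rewrite /poly_act comp_mpolyXU -tnth_nth tnth_mktuple. Qed.

Lemma mderiv_poly_act s p j :
  (poly_act s p)^`M(j) = \sum_l (invmx s l j)%:MP * poly_act s p^`M(l).
Proof.
rewrite /poly_act mderiv_comp; apply: eq_bigr => l _; rewrite mulrC; congr (_ * _).
rewrite tnth_mktuple raddf_sum (bigD1 j) //= big1 => [|m /negPf nm].
  by rewrite mderivZ mderivXU eqxx addr0 -mul_mpolyC mulr1.
by rewrite mderivZ mderivXU nm scaler0.
Qed.

Definition theta_frame s (i : 'I_n) : SP := sp_linear (fun j => (invmx s i j)%:MP).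
Definition psi_frame s (i : 'I_n) : SP := sp_linear (fun j => (s j i)%:MP).

(** The action on [k[x, theta]], for which the forms [df_I] are invariant. *)
Definition theta_act s u : SP := sp_subst (poly_act s) (theta_frame s) u.

Lemma psi_actE s u : psi_act s u = sp_subst (poly_act s) (psi_frame s) u.
Proof.
apply: eq_bigr => I _; congr (_ * _); apply: eq_bigr => i _.
by apply: eq_bigr => j _; rewrite sp_polyZ.
Qed.

Lemma theta_frame_anticommuting s : anticommuting (theta_frame s).
Proof. exact: sp_linear_anticommuting. Qed.

Lemma psi_frame_anticommuting s : anticommuting (psi_frame s).
Proof. exact: (sp_linear_anticommuting (fun i j => (s j i)%:MP)). Qed.

Lemma theta_act_prod s (T : Type) (r : seq T) (P : pred T) (F : T -> SP) :
  theta_act s (\prod_(i <- r | P i) F i) = \prod_(i <- r | P i) theta_act s (F i).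
Proof. exact: (sp_subst_prod _ _ _ _ (theta_frame_anticommuting s)). Qed.

Lemma theta_act_d s p : theta_act s (sp_d (sp_poly p)) = sp_d (sp_poly (poly_act s p)).
Proof.
rewrite !sp_d_poly /theta_act /sp_linear.
rewrite (sp_subst_lin _ _ (theta_frame_anticommuting s)).
under [RHS]eq_bigr => j _ do rewrite mderiv_poly_act rmorph_sum mulr_suml.
rewrite exchange_big; apply: eq_bigr => l _; rewrite mulr_sumr; apply: eq_bigr => j _.
by rewrite [_%:MP * _]mulrC rmorphM -mulrA.
Qed.

Section Invertible.
Variables (s : 'M[k]_n) (s_unit : s \in unitmx).

Lemma frames_dual (i j : 'I_n) :
  \sum_l (invmx s i l)%:MP * (s l j)%:MP = (i == j)%:R :> {mpoly k[n]}.
Proof.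
under eq_bigr => l _ do rewrite -rmorphM.
rewrite -rmorph_sum; have := congr1 (fun M : 'M_n => M i j) (mulVmx s_unit).
by rewrite !mxE => ->; rewrite rmorph_nat.
Qed.

Lemma sp_dot_frames (J K : {set 'I_n}) :
  sp_dot (\prod_(i in J) theta_frame s i) (\prod_(i in K) psi_frame s i) = (J == K)%:R.
Proof. exact: (sp_dot_dual frames_dual). Qed.

(** The pairing is equivariant because the theta_i and the psi_i are transformed by mutually inverse
    matrices, hence into dual families. *)
Lemma sp_dot_act u w :
  sp_dot (theta_act s u) (psi_act s w) = poly_act s (sp_dot u w).
Proof.
rewrite psi_actE /theta_act /sp_subst sp_dot_suml [in RHS]/sp_dot /poly_act rmorph_sum.
apply: eq_bigr => J _; rewrite sp_dot_sumr (bigD1 J) //= [X in _ + X]big1 => [|K nK].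
  by rewrite sp_dot_polyl sp_dot_polyr sp_dot_frames eqxx mulr1 addr0 rmorphM.
by rewrite sp_dot_polyl sp_dot_polyr sp_dot_frames eq_sym (negPf nK) !mulr0.
Qed.

Variable cj : {rmorphism k -> k}.
Hypothesis unitary_s : forall i j, cj (invmx s i j) = s j i.

(** Both sides are multiplicative in [p], so the variables decide. By the chain rule d/dx_i
    transforms by the entries [s j i], and by unitarity these are the conjugates of the coefficients
    in the image of x_i. *)
Lemma diff_op_act p h : poly_act s (diff_op cj p h) = diff_op cj (poly_act s p) (poly_act s h).
Proof.
elim/mpoly_gen_ind: p h => [c h|i h|p q IHp IHq h|p q IHp IHq h].
- rewrite /poly_act comp_mpolyC -[c%:MP]mulr1 mul_mpolyC !diff_opZl -mpolyX0 !diff_opX.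
  by rewrite !mderivm0m comp_mpolyZ.
- rewrite diff_opX mderivmU1m poly_actXU diff_op_suml.
  under eq_bigr => j _ do rewrite diff_opZl unitary_s diff_opX mderivmU1m mderiv_poly_act.
  under eq_bigr => j _ do rewrite scaler_sumr.
  rewrite exchange_big (bigD1 i) //=.
  have E l : \sum_j s j i *: ((invmx s l j)%:MP * poly_act s h^`M(l)) =
      (l == i)%:R * poly_act s h^`M(l).
    rewrite -frames_dual mulr_suml; apply: eq_bigr => j _.
    by rewrite -mul_mpolyC mulrCA mulrA.
  rewrite E eqxx mul1r big1 ?addr0 // => l /negPf nl.
  by rewrite E nl mul0r.
- by rewrite diff_opDl !rmorphD diff_opDl /= IHp IHq.
- by rewrite diff_opM IHp IHq rmorphM diff_opM.
Qed.

(** Invariance writes [u J'] as a combination of transformed coordinates of [u] with constants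
    [a J]. The conjugation inside [diff_op] turns these constants into the coordinates of the
    transformed psi_J. *)
Lemma psi_act_diff_op c u h : theta_act s u = u -> poly_act s h = c *: h ->
  psi_act s [ffun J => diff_op cj (u J) h] = c *: [ffun J => diff_op cj (u J) h] :> SP.
Proof.
move=> inv_u inv_h; rewrite psi_actE; apply/ffunP => J'.
pose a (J : {set 'I_n}) := (\prod_(i in J) theta_frame s i) J'.
(* Replacing every coefficient by its constant term is a ring morphism that fixes each
   [theta_frame s i], hence also their products. *)
have a_const J : a J = ((a J)@_0%MM)%:MP.
  have := sp_subst_coord (GRing.RMorphism.clone _ _ (@mpolyC n k \o mcoeff 0%MM) _)
    (\prod_(i in J) theta_frame s i) J'.
  rewrite (sp_subst_prod _ _ _ _ (@anticommuting_gen n k)) => /= <-.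
  congr ((_ : SP) _); apply: eq_bigr => i _.
  rewrite /theta_frame /sp_linear (sp_subst_lin _ _ (@anticommuting_gen n k)).
  by apply: eq_bigr => j _; rewrite /= mpolyCK.
(* The same device with conjugation of coefficients, which by unitarity takes [theta_frame] to
   [psi_frame]. *)
have b_conj (J : {set 'I_n}) : (\prod_(i in J) psi_frame s i) J' = map_mpoly cj (a J).
  have := sp_subst_coord (GRing.RMorphism.clone _ _ (map_mpoly cj) _)
    (\prod_(i in J) theta_frame s i) J'.
  rewrite (sp_subst_prod _ _ _ _ (@anticommuting_gen n k)) => /= <-.
  congr ((_ : SP) _); apply: eq_bigr => i _.
  rewrite /theta_frame /psi_frame /sp_linear (sp_subst_lin _ _ (@anticommuting_gen n k)).
  by apply: eq_bigr => j _; rewrite /= map_mpolyC -unitary_s.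
have uE : u J' = \sum_J poly_act s (u J) * a J.
  by rewrite -{1}inv_u /theta_act /sp_subst sum_ffunE; apply: eq_bigr => J _; rewrite sp_polyM.
rewrite !ffunE uE diff_op_suml scaler_sumr /sp_subst sum_ffunE; apply: eq_bigr => J _.
rewrite sp_polyM ffunE diff_op_act inv_h b_conj a_const map_mpolyC [_ * (_)%:MP]mulrC mul_mpolyC.
by rewrite [_ * (_)%:MP]mulrC mul_mpolyC diff_opZl diff_opZr !scalerA mulrC.
Qed.

End Invertible.

End Action.

(** * Determinants of perturbed matrices *)

Lemma det_rank1_update (R : comNzRingType) n (c : 'cV[R]_n) (r : 'rV[R]_n) :
  \det (1%:M + c *m r) = 1 + (r *m c) 0 0.
Proof.
have E : block_mx 1%:M 0 r (1%:M : 'M_1) *m (block_mx (1%:M + c *m r) c 0 1%:M *m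
    block_mx 1%:M 0 (- r) 1%:M) = block_mx 1%:M c 0 (1%:M + r *m c).
  rewrite !mulmx_block !(mul1mx, mulmx1, mul0mx, mulmx0, add0r, addr0, mulmxN).
  by rewrite -addrA subrr addr0 mulmx1 subrr [r *m c + _]addrC.
have := congr1 determinant E; rewrite !det_mulmx !det_lblock !det_ublock !det1 !(mul1r, mulr1).
by rewrite det_mx11 !mxE eqxx.
Qed.

Lemma horner_congr (R : comNzRingType) (q : {poly R}) d : exists c, q.[d] = q.[0] + d * c.
Proof.
elim/poly_ind: q => [|q a _]; first by exists 0; rewrite !horner0 mulr0 addr0.
by exists q.[d]; rewrite !hornerE ?mulr0 ?add0r addrC mulrC.
Qed.

(** With [A = B + d F], both determinants are values, at [d] and at 0, of the polynomial det(B + X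
    F). *)
Lemma det_congr (R : comNzRingType) n (d : R) (A B : 'M[R]_n) :
  (forall i j, exists c, A i j = B i j + d * c) -> exists c, \det A = \det B + d * c.
Proof.
move=> AB.
have [F FP] := fin_all_exists (fun ij : 'I_n * 'I_n => AB ij.1 ij.2).
pose M : 'M[{poly R}]_n := map_mx polyC B + 'X *: map_mx polyC (\matrix_(i, j) F (i, j)).
have E x : (\det M).[x] = \det (B + x *: \matrix_(i, j) F (i, j)).
  rewrite -[LHS]/(horner_eval x (\det M)) -det_map_mx; congr (\det _).
  by apply/matrixP => i j; rewrite /M !mxE /= /horner_eval !hornerE.
have -> : A = B + d *: \matrix_(i, j) F (i, j).
  by apply/matrixP => i j; rewrite !mxE (FP (i, j)).
by have [c] := horner_congr (\det M) d; rewrite !E scale0r addr0; exists c.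
Qed.

Section MpolyEval.
Variables (n : nat) (k : fieldType) (A : comNzRingType) (h : {rmorphism k -> A}).
Implicit Types (p q : {mpoly k[n]}) (x : 'I_n -> A).

Lemma mmap_XU x i : mmap h x 'X_i = x i.
Proof. by rewrite mmapX mmap1U. Qed.

Lemma mmap_ext x x' p : x =1 x' -> mmap h x p = mmap h x' p.
Proof.
move=> exx'; rewrite /mmap; apply: eq_bigr => m _; congr (_ * _).
exact: mmap1_eq.
Qed.

Lemma mmap_comp_mpoly m (lq : m.-tuple {mpoly k[n]}) (p : {mpoly k[m]}) x :
  mmap h x (p \mPo lq) = mmap h (fun i => mmap h x (tnth lq i)) p.
Proof.
elim/mpoly_gen_ind: p => [c|i|p q IHp IHq|p q IHp IHq].
- by rewrite comp_mpolyC !mmapC.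
- by rewrite comp_mpolyXU -tnth_nth mmapX mmap1U.
- by rewrite rmorphD !mmapD IHp IHq.
- by rewrite !rmorphM /= IHp IHq.
Qed.

Lemma mmap_poly_act (s : 'M[k]_n) x p :
  mmap h x (poly_act s p) = mmap h (fun i => \sum_j h (invmx s i j) * x j) p.
Proof.
rewrite mmap_comp_mpoly; apply: mmap_ext => i; rewrite tnth_mktuple raddf_sum.
by apply: eq_bigr => j _; rewrite /= mmapZ mmap_XU.
Qed.

Lemma rmorph_mmap (B : comNzRingType) (phi : {rmorphism A -> B}) (h' : {rmorphism k -> B}) x p :
  (forall c, phi (h c) = h' c) -> phi (mmap h x p) = mmap h' (phi \o x) p.
Proof.
move=> hh'; elim/mpoly_gen_ind: p => [c|i|p q IHp IHq|p q IHp IHq].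
- by rewrite !mmapC hh'.
- by rewrite !mmapX !mmap1U.
- by rewrite !mmapD rmorphD IHp IHq.
- by rewrite !rmorphM /= IHp IHq.
Qed.

End MpolyEval.

(** * Finite matrix groups and averages *)

Section FiniteMatrixGroup.
Variables (n : nat) (k : fieldType).
Implicit Types (G : seq 'M[k]_n) (s t : 'M[k]_n).

(** Closure under inverses follows from finiteness ([matrix_group_inv]). Lists make stabilisers
    filters and averages plain sums. *)
Definition matrix_group G :=
  [/\ uniq G, {in G, forall s, s \in unitmx}, 1%:M \in G & {in G &, forall s t, s *m t \in G}].

Definition stabiliser G (v : 'cV[k]_n) := [seq s <- G | s *m v == v].

Lemma stabiliser_group G v : matrix_group G -> matrix_group (stabiliser G v).
Proof.
case=> uG unitG G1 GM; split=> [|s||].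
- exact: filter_uniq.
- by rewrite mem_filter => /andP[_]; apply: unitG.
- by rewrite mem_filter mul1mx eqxx.
move=> s t; rewrite !mem_filter => /andP[/eqP sv sG] /andP[/eqP tv tG].
by rewrite -mulmxA tv sv eqxx GM.
Qed.

Lemma perm_lmul G s : matrix_group G -> s \in G -> perm_eq [seq s *m t | t <- G] G.
Proof.
case=> uG unitG G1 GM sG.
have uim : uniq [seq s *m t | t <- G].
  by rewrite map_inj_uniq //; apply: can_inj (mulKmx (unitG s sG)).
have sub : {subset [seq s *m t | t <- G] <= G} by move=> _ /mapP[t tG ->]; apply: GM.
have [] := uniq_min_size uim sub; first by rewrite size_map.
by move=> _ /(uniq_perm uim uG).
Qed.

Lemma perm_rmul G s : matrix_group G -> s \in G -> perm_eq [seq t *m s | t <- G] G.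
Proof.
case=> uG unitG G1 GM sG.
have uim : uniq [seq t *m s | t <- G].
  by rewrite map_inj_uniq //; apply: can_inj (mulmxK (unitG s sG)).
have sub : {subset [seq t *m s | t <- G] <= G} by move=> _ /mapP[t tG ->]; apply: GM.
have [] := uniq_min_size uim sub; first by rewrite size_map.
by move=> _ /(uniq_perm uim uG).
Qed.

Lemma matrix_group_inv G s : matrix_group G -> s \in G -> invmx s \in G.
Proof.
move=> gG sG; have [uG unitG G1 GM] := gG.
have := perm_mem (perm_lmul gG sG) 1%:M; rewrite G1 => /mapP[t tG est].
by rewrite -(mulKmx (unitG s sG) t) -est mulmx1 in tG.
Qed.

Lemma poly_actM s t p : s \in unitmx -> t \in unitmx ->
  poly_act s (poly_act t p) = poly_act (s *m t) p.
Proof.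
move=> us ut; rewrite {1}/poly_act /comp_mpoly mmap_poly_act.
have -> : poly_act (s *m t) p = mmap (@mpolyC n k)
    (tnth [tuple \sum_(j < n) invmx (s *m t) i j *: 'X_j | i < n]) p by [].
have -> : invmx (s *m t) = invmx t *m invmx s.
  have ust : s *m t \in unitmx by rewrite unitmx_mul us.
  by apply: (can_inj (mulKmx ust)); rewrite mulmxV // mulmxA mulmxK // mulmxV.
apply: mmap_ext => i; rewrite tnth_mktuple.
under [RHS]eq_bigr => j _ do rewrite mxE scaler_suml.
rewrite exchange_big; apply: eq_bigr => l _ /=; rewrite tnth_mktuple mulr_sumr.
by apply: eq_bigr => j _; rewrite mul_mpolyC scalerA.
Qed.

Definition average G : 'M[k]_n := (size G)%:R^-1 *: \sum_(s <- G) s.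

Lemma average_lmul G s : matrix_group G -> s \in G -> s *m average G = average G.
Proof.
move=> gG sG; rewrite /average -scalemxAr mulmx_sumr; congr (_ *: _).
by rewrite -(big_map (fun t => s *m t) xpredT id) (perm_big _ (perm_lmul gG sG)).
Qed.

Lemma average_rmul G s : matrix_group G -> s \in G -> average G *m s = average G.
Proof.
move=> gG sG; rewrite /average -scalemxAl mulmx_suml; congr (_ *: _).
by rewrite -(big_map (fun t => t *m s) xpredT id) (perm_big _ (perm_rmul gG sG)).
Qed.

End FiniteMatrixGroup.

(** * Invariants near a point with cyclic stabiliser *)

Section PointEval.
Variables (n : nat) (k : fieldType).
Implicit Types (p q : {mpoly k[n]}) (u v : 'cV[k]_n).

Definition pt u : 'I_n -> k := fun i => u i 0.

Lemma meval_poly_act (s : 'M[k]_n) p v : (poly_act s p).@[pt v] = p.@[pt (invmx s *m v)].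
Proof. by rewrite /meval mmap_poly_act; apply: mmap_ext => i; rewrite /pt mxE. Qed.

Lemma separating_point u v : u != v -> exists q, q.@[pt u] = 0 /\ q.@[pt v] = 1.
Proof.
move=> nuv; have [i nui] : exists i, u i 0 != v i 0.
  apply/existsP; apply: contraR nuv; rewrite negb_exists => /forallP euv.
  by apply/eqP/colP => i; apply/eqP; rewrite -[_ == _]negbK euv.
exists ((v i 0 - u i 0)^-1 *: ('X_i - (u i 0)%:MP)).
rewrite !mevalZ !mevalB !mevalXU !mevalC /pt subrr mulr0; split=> //.
by rewrite mulVf // subr_eq0 eq_sym.
Qed.

Lemma separating_points (us : seq 'cV[k]_n) v : v \notin us ->
  exists q, {in us, forall u, q.@[pt u] = 0} /\ q.@[pt v] = 1.
Proof.
elim: us => [|u us IH]; first by exists 1; rewrite meval1.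
rewrite inE negb_or eq_sym => /andP[/separating_point[q1 [q1u q1v]] /IH[q2 [q2u q2v]]].
exists (q1 * q2); rewrite mevalM q1v q2v mulr1; split=> // x.
by rewrite inE mevalM => /predU1P[->|/q2u ->]; rewrite ?q1u ?mul0r ?mulr0.
Qed.

Lemma mderivXn q e j : (q ^+ e.+1)^`M(j) = q ^+ e * (e.+1%:R * q^`M(j)).
Proof.
elim: e => [|e IH]; first by rewrite expr1 expr0 !mul1r.
by rewrite exprS mderivM IH exprS [e.+2%:R]mulrS; ring.
Qed.

Variables (v b : 'cV[k]_n).

Definition line_eval p : {poly k} := mmap (@polyC k) (fun i => (v i 0)%:P + b i 0 *: 'X) p.

HB.instance Definition _ := GRing.RMorphism.copy line_eval
  (mmap (@polyC k) (fun i => (v i 0)%:P + b i 0 *: 'X)).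

Lemma line_evalXU i : line_eval 'X_i = (v i 0)%:P + b i 0 *: 'X.
Proof. exact: mmap_XU. Qed.

Lemma line_evalC c : line_eval c%:MP = c%:P.
Proof. exact: mmapC. Qed.

Lemma line_evalZ c p : line_eval (c *: p) = c *: line_eval p.
Proof. by rewrite /line_eval mmapZ mul_polyC. Qed.

Lemma horner_line_eval p t : (line_eval p).[t] = p.@[pt (v + t *: b)].
Proof.
rewrite -[LHS]/(horner_eval t (line_eval p)) /line_eval.
rewrite (rmorph_mmap _ _ (h' := GRing.RMorphism.clone _ _ (@idfun k) _)) => [|c]; last first.
  by rewrite /= /horner_eval hornerC.
by apply: mmap_ext => i; rewrite /pt /= /horner_eval !hornerE !mxE mulrC.
Qed.

Lemma dvdX_line_eval p : p.@[pt v] = 0 -> 'X %| line_eval p.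
Proof.
move=> pv0; have -> : 'X = 'X - 0%:P :> {poly k} by rewrite subr0.
by rewrite dvdp_XsubCl /root horner_line_eval scale0r addr0 pv0.
Qed.

(** Exactly what is needed to compare Jacobian matrices modulo a power of the parameter of the line:
    only first partial derivatives, and only along the line. *)
Definition flat e p := forall j, 'X^e %| line_eval p^`M(j).

Lemma flatD e p q : flat e p -> flat e q -> flat e (p + q).
Proof. by move=> hp hq j; rewrite mderivD rmorphD dvdp_add. Qed.

Lemma flat_sum e (T : eqType) (r : seq T) (F : T -> {mpoly k[n]}) :
  {in r, forall t, flat e (F t)} -> flat e (\sum_(t <- r) F t).
Proof.
elim: r => [|t r IH] hF; first by rewrite big_nil => j; rewrite mderiv0 rmorph0 dvdp0.
rewrite big_cons; apply: flatD; first by apply: hF; rewrite mem_head.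
by apply: IH => x xr; apply: hF; rewrite inE xr orbT.
Qed.

Lemma flatZ e c p : flat e p -> flat e (c *: p).
Proof. by move=> hp j; rewrite mderivZ line_evalZ -mul_polyC dvdp_mull. Qed.

Lemma flat_pow e p q : q.@[pt v] = 0 -> flat e (p * q ^+ e.+1).
Proof.
move=> q0 j.
have Xq : 'X^e %| line_eval q ^+ e by apply: dvdp_exp2r; exact: dvdX_line_eval.
rewrite mderivM mderivXn rmorphD !rmorphM !rmorphXn /= exprSr.
by apply: dvdp_add; [apply: dvdp_mull; apply: dvdp_mulr | apply: dvdp_mull; apply: dvdp_mulr].
Qed.

End PointEval.

Section Local.
Variables (n : nat) (C : fieldType).
Hypothesis charC : forall m, m.+1%:R != 0 :> C.
Variables (G : seq 'M[C]_n) (v b beta : 'cV[C]_n) (ell : 'rV[C]_n).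
Hypothesis gG : matrix_group G.
Let Gam := stabiliser G v.
Let e := (size Gam).-1.
Let gGam : matrix_group Gam := stabiliser_group v gG.
(** The fixed space of the stabiliser has codimension at most 1; a trivial stabiliser is included,
    with product 0. *)
Hypothesis avgE : 1%:M - average Gam = beta *m ell.
Hypothesis generic_b : 1%:M - average Gam != 0 -> (1%:M - average Gam) *m b != 0.

Let sizeGam : size Gam = e.+1.
Proof. by have [_ _ G1 _] := gGam; rewrite /e; case: Gam G1. Qed.

Lemma average_idem : average Gam *m average Gam = average Gam.
Proof.
rewrite {1}/average -scalemxAl mulmx_suml big_seq.
under eq_bigr => s sG do rewrite (average_lmul gGam sG).
rewrite -big_seq big_const_seq count_predT iter_addr_0 -scaler_nat scalerA sizeGam.
by rewrite mulVf ?scale1r // charC.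
Qed.

Lemma average_eq1 : average Gam = 1%:M -> e = 0%N /\ {in Gam, forall s, s = 1%:M}.
Proof.
move=> avg1; have Gam1 : {in Gam, forall s, s = 1%:M}.
  by move=> s sG; have := average_lmul gGam sG; rewrite avg1 mulmx1.
split=> //; rewrite /e; have [uG _ _ _] := gGam.
have := @uniq_leq_size _ Gam [:: 1%:M] uG; case: (size Gam) => [//|[//|m]] /= H.
by have /H : {subset Gam <= [:: 1%:M]} by move=> s /Gam1 ->; rewrite inE.
Qed.

(** The projection [beta *m ell] is idempotent: if it is 0 the stabiliser is trivial, otherwise
    [ell *m beta] is 1 and the direction [b] is transverse to the reflecting hyperplane. *)
Lemma stabiliser_dichotomy :
  (e = 0%N /\ {in Gam, forall s, s = 1%:M}) \/ ((ell *m beta) 0 0 = 1 /\ (ell *m b) 0 0 != 0).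
Proof.
have [M0|nM0] := eqVneq (1%:M - average Gam) 0.
  by left; apply: average_eq1; apply/esym/eqP; rewrite -subr_eq0 M0.
right; have := generic_b nM0; rewrite avgE -mulmxA => nb.
have idem : (beta *m ell) *m (beta *m ell) = beta *m ell.
  by rewrite -avgE mulmxBl mul1mx mulmxBr mulmx1 average_idem subrr subr0.
split; last first.
  by apply: contraNneq nb => lb0; rewrite [ell *m b]mx11_scalar lb0 raddf0 mulmx0.
set c := (ell *m beta) 0 0; have cE : ell *m beta = c%:M by exact: mx11_scalar.
have : (c - 1) *: (beta *m ell) = 0.
  move: idem; rewrite mulmxA -[beta *m ell *m beta]mulmxA cE mul_mx_scalar -scalemxAl.
  by move=> idem; rewrite scalerBl scale1r idem subrr.
by move/eqP; rewrite scaler_eq0 -avgE (negPf nM0) orbF subr_eq0 => /eqP.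
Qed.

Section Reflection.
Hypothesis dual1 : (ell *m beta) 0 0 = 1.

Let ell_beta : ell *m beta = 1%:M.
Proof. by rewrite [LHS]mx11_scalar dual1. Qed.

Let averageE : average Gam = 1%:M - beta *m ell.
Proof. by rewrite -avgE subKr. Qed.

(** The eigenvalue of [s] on the line of [beta]. On the stabiliser it is a faithful character and
    equals the determinant. *)
Definition chi (s : 'M[C]_n) : C := (ell *m s *m beta) 0 0.

Lemma ell_mul s : s \in Gam -> ell *m s = chi s *: ell.
Proof.
move=> sG; have : ell *m (s *m average Gam) = 0.
  by rewrite (average_lmul gGam sG) averageE mulmxBr mulmx1 mulmxA ell_beta mul1mx subrr.
rewrite averageE !mulmxBr mulmx1 !mulmxA [ell *m s *m beta]mx11_scalar mul_scalar_mx.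
by move/eqP; rewrite subr_eq0 => /eqP.
Qed.

Lemma mul_beta s : s \in Gam -> s *m beta = chi s *: beta.
Proof.
move=> sG; have : (average Gam *m s) *m beta = 0.
  by rewrite (average_rmul gGam sG) averageE mulmxBl mul1mx -mulmxA ell_beta mulmx1 subrr.
rewrite averageE !mulmxBl mul1mx -!mulmxA [ell *m _]mulmxA [ell *m s *m beta]mx11_scalar.
by rewrite mul_mx_scalar => /eqP; rewrite subr_eq0 => /eqP.
Qed.

Lemma stabiliserE s : s \in Gam -> s = 1%:M + (chi s - 1) *: (beta *m ell).
Proof.
move=> sG; have := average_lmul gGam sG; rewrite averageE mulmxBr mulmx1 mulmxA.
rewrite (mul_beta sG) -scalemxAl => /eqP; rewrite subr_eq => /eqP sE.
by rewrite {1}sE scalerBl scale1r -addrA [- _ + _]addrC.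
Qed.

Lemma det_stabiliser s : s \in Gam -> \det s = chi s.
Proof.
move=> sG; rewrite {1}(stabiliserE sG) scalemxAl det_rank1_update -scalemxAr ell_beta.
by rewrite !mxE eqxx mulr1 addrC subrK.
Qed.

Lemma chiM s t : s \in Gam -> chi (s *m t) = chi s * chi t.
Proof.
by move=> sG; rewrite {1}/chi mulmxA (ell_mul sG) -!scalemxAl mxE.
Qed.

Lemma chi1 : chi 1%:M = 1.
Proof. by rewrite /chi mulmx1. Qed.

Lemma chi_neq0 s : s \in Gam -> chi s != 0.
Proof.
move=> sG; have [_ uG _ _] := gGam.
have := chiM (invmx s) sG; rewrite mulmxV ?uG // chi1 => /eqP.
by apply: contraTneq => ->; rewrite mul0r oner_eq0.
Qed.

(** Lagrange's argument: translation by [s] permutes the factors of [P] and multiplies [P] by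
    [chi s ^+ e.+1]. *)
Lemma chi_exp s : s \in Gam -> chi s ^+ e.+1 = 1.
Proof.
move=> sG; pose P := \prod_(t <- Gam) chi t.
have nP : P != 0.
  by rewrite /P prodf_seq_neq0; apply/allP => t tG /=; apply: chi_neq0.
apply: (mulIf nP); rewrite mul1r {2}/P -(perm_big _ (perm_lmul gGam sG)) big_map.
under eq_bigr => t _ do rewrite chiM //.
by rewrite big_split big_const_seq count_predT iter_mulr_1 sizeGam.
Qed.

Lemma chi_inj : {in Gam &, injective chi}.
Proof. by move=> s t sG tG est; rewrite (stabiliserE sG) est -(stabiliserE tG). Qed.

End Reflection.

Definition lin_form (r : 'rV[C]_n) : {mpoly C[n]} := \sum_j r 0 j *: 'X_j.

Lemma lin_form_act s r : poly_act s (lin_form r) = lin_form (r *m invmx s).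
Proof.
rewrite /lin_form raddf_sum /=.
under eq_bigr => j _ do rewrite linearZ /= poly_actXU scaler_sumr.
rewrite exchange_big; apply: eq_bigr => j _ /=; rewrite mxE scaler_suml.
by apply: eq_bigr => i _; rewrite scalerA.
Qed.

Lemma lin_formB c r r' : lin_form (r - c *: r') = lin_form r - c *: lin_form r'.
Proof.
rewrite /lin_form scaler_sumr -sumrB; apply: eq_bigr => j _.
by rewrite !mxE scalerBl scalerA.
Qed.

Lemma lin_form_delta i : lin_form (delta_mx 0 i) = 'X_i.
Proof.
rewrite /lin_form (bigD1 i) //= big1 => [|j /negPf nj]; rewrite !mxE eqxx /=.
  by rewrite eqxx scale1r addr0.
by rewrite nj scale0r.
Qed.

Lemma mderiv_lin_form r j : (lin_form r)^`M(j) = (r 0 j)%:MP.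
Proof.
rewrite /lin_form raddf_sum (bigD1 j) //= big1 => [|i /negPf ni].
  by rewrite mderivZ mderivXU eqxx addr0 -mul_mpolyC mulr1.
by rewrite mderivZ mderivXU ni scaler0.
Qed.

Definition ell_v : {mpoly C[n]} := lin_form ell - ((ell *m v) 0 0)%:MP.

(* Coordinates of the map x |-> v + pi (x - v) + ell (x - v)^(e+1) beta, where pi is
   the projection on the fixed hyperplane of the stabiliser and e + 1 its order. *)
Definition local_inv (i : 'I_n) : {mpoly C[n]} :=
  'X_i - beta i 0 *: ell_v + beta i 0 *: ell_v ^+ e.+1.

(** The affine part has linear form [row i (average Gam)], unchanged by right multiplication with
    the stabiliser; [ell_v] is scaled by a value of [chi], whose power [e.+1] is 1. For [e = 0] the
    polynomial is just ['X_i]. *)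
Lemma local_inv_act s i : s \in Gam -> poly_act s (local_inv i) = local_inv i.
Proof.
case: stabiliser_dichotomy => [[_ Gam1]|[dual1 _]] sG.
  rewrite (Gam1 s sG) /poly_act -[RHS]comp_mpoly_id; congr (_ \mPo _).
  apply: eq_mktuple => j; rewrite invmx1 (bigD1 j) //= big1 => [|l nl].
    by rewrite mxE eqxx scale1r addr0.
  by rewrite mxE eq_sym (negPf nl) scale0r.
have tG := matrix_group_inv gGam sG; set t := invmx s in tG.
have tv : t *m v = v by move: tG; rewrite mem_filter => /andP[/eqP].
have ell_vE : poly_act s ell_v = chi t *: ell_v.
  rewrite /ell_v raddfB /= lin_form_act -/t (ell_mul dual1 tG).
  rewrite -{1}tv mulmxA (ell_mul dual1 tG) /poly_act comp_mpolyC scalerBr.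
  have -> : lin_form (chi t *: ell) = chi t *: lin_form ell.
    by rewrite /lin_form scaler_sumr; apply: eq_bigr => j _; rewrite mxE scalerA.
  by rewrite -scalemxAl mxE mpolyCM mul_mpolyC.
have projE : 'X_i - beta i 0 *: ell_v =
    lin_form (row i (average Gam)) + (beta i 0 * (ell *m v) 0 0)%:MP.
  rewrite /ell_v scalerBr opprB addrCA -lin_form_delta -lin_formB addrC.
  rewrite mpolyCM mul_mpolyC; congr (lin_form _ + _).
  rewrite -[average Gam](subKr 1%:M) avgE; apply/rowP => j; rewrite !mxE big_ord1.
  by rewrite eqxx [j == i]eq_sym.
have proj_act : poly_act s ('X_i - beta i 0 *: ell_v) = 'X_i - beta i 0 *: ell_v.
  rewrite projE rmorphD /= lin_form_act -/t -row_mul (average_rmul gGam tG).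
  by rewrite /poly_act comp_mpolyC.
rewrite /local_inv rmorphD /= proj_act [poly_act s (_ *: _)]linearZ /= rmorphXn /= ell_vE exprZn.
by rewrite (chi_exp dual1 tG) scale1r.
Qed.

Lemma line_eval_ell_v : line_eval v b ell_v = (ell *m b) 0 0 *: 'X.
Proof.
rewrite /ell_v rmorphB /= line_evalC /lin_form raddf_sum /=.
under eq_bigr => j _ do rewrite line_evalZ line_evalXU scalerDr scalerA.
rewrite big_split /= -scaler_suml.
have -> : \sum_j ell 0 j *: (v j 0)%:P = ((ell *m v) 0 0)%:P.
  by rewrite mxE rmorph_sum; apply: eq_bigr => j _; rewrite -mul_polyC -polyCM.
by rewrite addrAC subrr add0r [in RHS]mxE.
Qed.

Lemma det_local_inv :
  \det (\matrix_(i, j) line_eval v b (local_inv i)^`M(j)) =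
  e.+1%:R * ((ell *m b) 0 0 *: 'X) ^+ e.
Proof.
(* The derivative of L^(e+1) - L at L = [ell_v], restricted to the line: the Jacobian matrix is the
   identity plus a rank one matrix with this factor. *)
pose w : {poly C} := e.+1%:R * ((ell *m b) 0 0 *: 'X) ^+ e - 1.
have -> : \matrix_(i, j) line_eval v b (local_inv i)^`M(j) =
    1%:M + (\col_i ((beta i 0)%:P * w)) *m (\row_j (ell 0 j)%:P).
  apply/matrixP => i j; rewrite !mxE big_ord1 !mxE.
  have dL : ell_v^`M(j) = (ell 0 j)%:MP by rewrite /ell_v mderivB mderiv_lin_form mderivC subr0.
  rewrite /local_inv mderivD mderivB !mderivZ mderivXn mderivXU dL.
  rewrite rmorphD rmorphB /= !line_evalZ !rmorphM rmorphXn /= line_evalC line_eval_ell_v.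
  by rewrite !rmorph_nat /w -!mul_polyC; ring.
rewrite det_rank1_update mxE.
have -> : \sum_j (\row_j0 (ell 0 j0)%:P) 0 j * (\col_i ((beta i 0)%:P * w)) j 0 =
    ((ell *m beta) 0 0)%:P * w.
  rewrite mxE rmorph_sum mulr_suml; apply: eq_bigr => j _.
  by rewrite !mxE rmorphM /= mulrA.
case: stabiliser_dichotomy => [[e0 _]|[-> _]]; last by rewrite mul1r /w addrC subrK.
by rewrite /w e0 !expr0 !mulr1 subrr mulr0 addr0.
Qed.

Variable f : n.-tuple {mpoly C[n]}.
Hypothesis reynolds : forall p, exists Q, \sum_(s <- G) poly_act s p = Q \mPo f.

(** Average [local_inv i * E] for a cut-off polynomial [E] that is close to 1 at [v] and close to 0
    on the rest of its orbit. To high order at [v], each of the [e.+1] elements of the stabiliser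
    contributes [local_inv i] and the other elements contribute nothing. *)
Lemma local_approx i : exists Q : {mpoly C[n]}, flat v b e.+1 (Q \mPo f - local_inv i).
Proof.
pose orbit := [seq invmx s *m v | s <- G & s \notin Gam].
have [_ uG _ _] := gG.
have [E0 [E0u E0v]] : exists q, {in orbit, forall u, q.@[pt u] = 0} /\ q.@[pt v] = 1.
  apply: separating_points; apply/mapP => -[s]; rewrite mem_filter => /andP[nsG sG] esv.
  by case/negP: nsG; rewrite mem_filter sG andbT {1}esv mulKVmx ?uG.
(* [E] is a multiple of [E0 ^+ N], and [1 - E] is an [N]-th power of a polynomial vanishing at [v].
   The exponent is [e.+2] because taking partial derivatives lowers the order of vanishing by
   one. *)
pose N := e.+2; pose E := 1 - (1 - E0 ^+ N) ^+ N.
have [c Ec] : exists c, E = c * E0 ^+ N.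
  have := subrXX 1 (1 - E0 ^+ N) N; rewrite expr1n subKr => EE.
  by rewrite /E EE mulrC; eexists.
have [Q QE] := reynolds (local_inv i * E).
exists (e.+1%:R^-1 *: Q).
have -> : (e.+1%:R^-1 *: Q) \mPo f - local_inv i = e.+1%:R^-1 *:
    \sum_(s <- G) (poly_act s (local_inv i * E) - local_inv i *+ (s \in Gam)).
  rewrite sumrB QE comp_mpolyZ scalerBr; congr (_ - _).
  have -> : \sum_(s <- G) local_inv i *+ (s \in Gam) = local_inv i *+ e.+1.
    rewrite (eq_big_seq (fun s => if s *m v == v then local_inv i else 0)) => [|s sG].
      by rewrite -big_mkcond big_const_seq iter_addr_0 -size_filter -/(stabiliser G v) sizeGam.
    by rewrite mulrb mem_filter sG andbT.
  by rewrite -scaler_nat scalerA mulVf ?scale1r.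
apply: flatZ; apply: flat_sum => s sG.
case: (boolP (s \in Gam)) => sGam; last first.
  rewrite subr0 Ec mulrA rmorphM rmorphXn /=; apply: flat_pow.
  rewrite meval_poly_act E0u //; apply/mapP; exists s => //.
  by rewrite mem_filter sGam.
rewrite mulr1n rmorphM /= local_inv_act // -{2}[local_inv i]mulr1 -mulrBr.
have -> : poly_act s E - 1 = - (1 - poly_act s E0 ^+ N) ^+ N.
  by rewrite /E rmorphB rmorph1 rmorphXn rmorphB rmorph1 rmorphXn /= addrC addKr.
rewrite mulrN -mulNr; apply: flat_pow.
rewrite mevalB meval1 rmorphXn /= meval_poly_act.
have /andP[/eqP tv _] : (invmx s *m v == v) && (invmx s \in G).
  by have := matrix_group_inv gGam sGam; rewrite mem_filter.
by rewrite tv E0v expr1n subrr.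
Qed.

(* The F_i = Q_i o f approximating [local_inv] have Jacobian det(dQ/df) Delta, so
   the order of Delta at v along b is at most that of the Jacobian of [local_inv]. *)
Lemma jacobian_order : ~~ ('X^(e.+1) %|
  line_eval v b (\det (\matrix_(i, j) (tnth f i)^`M(j)))).
Proof.
have /fin_all_exists[Q QP] := local_approx.
apply/negP => dvdJ.
pose JF := \matrix_(i, j) line_eval v b (Q i \mPo f)^`M(j).
have dvdJF : 'X^(e.+1) %| \det JF.
  have -> : JF = map_mx (line_eval v b) (\matrix_(i, l) ((Q i)^`M(l) \mPo f)) *m
      map_mx (line_eval v b) (\matrix_(i, j) (tnth f i)^`M(j)).
    apply/matrixP => i j; rewrite !mxE mderiv_comp rmorph_sum; apply: eq_bigr => l _.
    by rewrite rmorphM !mxE.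
  by rewrite det_mulmx !det_map_mx dvdp_mull.
have [c detE] : exists c, \det JF =
    \det (\matrix_(i, j) line_eval v b (local_inv i)^`M(j)) + 'X^(e.+1) * c.
  apply: det_congr => i j; rewrite !mxE.
  have /dvdpP[c cE] := QP i j; exists c.
  by rewrite [_ * c]mulrC -cE mderivB rmorphB /= addrC subrK.
have : 'X^(e.+1) %| e.+1%:R * ((ell *m b) 0 0 *: 'X) ^+ e.
  by rewrite -det_local_inv -(dvdp_addl _ (dvdp_mulIl 'X^(e.+1) c)) -detE.
have nz : e.+1%:R * ((ell *m b) 0 0) ^+ e != 0.
  rewrite mulf_neq0 // expf_eq0; case: stabiliser_dichotomy => [[-> _]//|[_ nb]].
  by rewrite negb_and nb orbT.
have -> : e.+1%:R * ((ell *m b) 0 0 *: 'X) ^+ e = (e.+1%:R * ((ell *m b) 0 0) ^+ e) *: 'X^e.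
  by rewrite exprZn -!mul_polyC polyCM rmorph_nat mulrA.
by rewrite dvdpZr // dvdp_Pexp2l ?size_polyX // ltnn.
Qed.

(* In direction beta the variable is scaled by chi(s)^-1, so only exponents i with
   chi(s)^(i+1) = 1 for all s in the stabiliser occur; there are e+1 such values. *)
Lemma semi_invariant_order p : {in Gam, forall s, poly_act s p = \det s *: p} ->
  'X^e %| line_eval v b p.
Proof.
move=> semi_p; case: stabiliser_dichotomy => [[-> _]|[dual1 nb]]; first exact: dvd1p.
pose h : {rmorphism C -> {poly {poly C}}} := GRing.RMorphism.clone _ _ (polyC \o polyC) _.
(* The point v + T pi(b) + S beta, with pi the average, T the inner and S the outer variable. The
   line is recovered at S = (ell b) T, since b = pi(b) + (ell b) beta. *)
pose x (i : 'I_n) : {poly {poly C}} :=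
  ((v i 0)%:P + ((average Gam *m b) i 0) *: 'X)%:P + (beta i 0)%:P *: 'X.
pose P := mmap h x p.
have coefP_eq0 i : (i < e)%N -> P`_i = 0.
  move=> ltie; apply/eqP; apply: contraTT ltie => nPi; rewrite -leqNgt -ltnS -sizeGam.
  have chi1 s : s \in Gam -> chi s ^+ i.+1 = 1.
    move=> sG; have tG := matrix_group_inv gGam sG.
    pose phi : {rmorphism {poly {poly C}} -> {poly {poly C}}} :=
      GRing.RMorphism.clone _ _ (comp_poly ((chi (invmx s))%:P *: 'X)) _.
    (* The inverse of [s] fixes v and pi(b) and scales beta by [chi (invmx s)], so rescaling S
       amounts to acting on [p], which multiplies it by det s. *)
    have phiP : phi P = (chi s)%:P *: P.
      have -> : (chi s)%:P *: P = mmap h x (poly_act s p).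
        by rewrite semi_p // (det_stabiliser dual1 sG) mmapZ -mul_polyC.
      rewrite mmap_poly_act /P (rmorph_mmap _ _ (h' := h)) => [|c]; last first.
        by rewrite /= comp_polyC.
      apply: mmap_ext => j /=; rewrite comp_polyD comp_polyC comp_polyZ comp_polyX.
      have tv : invmx s *m v = v by move: tG; rewrite mem_filter => /andP[/eqP].
      have tpi : invmx s *m (average Gam *m b) = average Gam *m b.
        by rewrite mulmxA (average_lmul gGam tG).
      have tb := mul_beta dual1 tG.
      have vE : v j 0 = \sum_l invmx s j l * v l 0 by rewrite -{1}tv mxE.
      have piE : (average Gam *m b) j 0 = \sum_l invmx s j l * (average Gam *m b) l 0.
        by rewrite -{1}tpi mxE.
      have bE : chi (invmx s) * beta j 0 = \sum_l invmx s j l * beta l 0.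
        by have := congr1 (fun M : 'cV_n => M j 0) tb; rewrite !mxE => <-.
      transitivity ((\sum_l (invmx s j l)%:P * ((v l 0)%:P + (average Gam *m b) l 0 *: 'X))%:P +
          (\sum_l (invmx s j l)%:P * (beta l 0)%:P) *: 'X).
        congr (_%:P + _).
          rewrite vE piE rmorph_sum scaler_suml -big_split; apply: eq_bigr => l _ /=.
          by rewrite mulrDr polyCM -scalerA -mul_polyC.
        rewrite scalerA -polyCM mulrC bE rmorph_sum; congr (_ *: _).
        by apply: eq_bigr => l _; rewrite /= polyCM.
      rewrite rmorph_sum scaler_suml -big_split; apply: eq_bigr => l _ /=.
      by rewrite /x [RHS]mulrDr -!mul_polyC !polyCM !mulrA.
    have chi_st : chi (invmx s) * chi s = 1.
      by rewrite -chiM // mulVmx ?chi1 //; have [_ ->] := gGam.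
    have : (phi P)`_i = (chi s)%:P * P`_i by rewrite phiP coefZ.
    have ltiP : (i < size P)%N by rewrite ltnNge; apply: contra nPi => /leq_sizeP ->.
    have -> : (phi P)`_i = P`_i * (chi (invmx s))%:P ^+ i.
      rewrite /= comp_polyE coef_sum (bigD1 (Ordinal ltiP)) //= big1 => [|l nl].
        by rewrite exprZn !coefZ coefXn eqxx mulr1 addr0.
      rewrite exprZn !coefZ coefXn [i == _]eq_sym.
      by rewrite -[l == i :> nat]/(val l == val (Ordinal ltiP)) (inj_eq val_inj) (negPf nl) !mulr0.
    rewrite mulrC => /(mulIf nPi) /eqP; rewrite -polyC_exp (inj_eq polyC_inj) => /eqP chiE.
    by rewrite exprS -{1}chiE -exprMn chi_st expr1n.
  have := @max_unity_roots _ i.+1 [seq chi s | s <- Gam] isT.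
  rewrite size_map; apply.
    by apply/allP => _ /mapP[s sG ->]; rewrite unity_rootE chi1.
  rewrite map_inj_in_uniq; first by have [] := gGam.
  exact: chi_inj.
have -> : line_eval v b p = P.[(ell *m b) 0 0 *: 'X].
  rewrite -[RHS]/(horner_eval ((ell *m b) 0 0 *: 'X) P) /P.
  rewrite (rmorph_mmap _ _ (h' := GRing.RMorphism.clone _ _ (@polyC C) _)) => [|c]; last first.
    by rewrite /= /horner_eval hornerC.
  apply: mmap_ext => j; rewrite /= /horner_eval !hornerE.
  have bE : b j 0 = (average Gam *m b) j 0 + beta j 0 * (ell *m b) 0 0.
    rewrite -{1}[b]mul1mx -[1%:M](subrK (average Gam)) mulmxDl avgE -mulmxA mxE addrC.
    by congr (_ + _); rewrite mxE big_ord1.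
  by rewrite bE scalerDl addrA -scalerA mul_polyC.
rewrite horner_coef; apply: (big_ind (fun q => 'X^e %| q)) => [||i _].
- exact: dvdp0.
- by move=> q1 q2; apply: dvdp_add.
have [/coefP_eq0 ->|leei] := ltnP i e; first by rewrite mul0r dvdp0.
by rewrite dvdp_mull // exprZn -mul_polyC dvdp_mull // dvdp_exp2l.
Qed.

End Local.

(** * Divisibility of semi-invariants by the Jacobian *)

(** Cancel one root of [p] from both polynomials at a time; over a closed field this ends with [p]
    constant. *)
Lemma dvdp_by_order (C : closedFieldType) (p q : {poly C}) : p != 0 ->
  (forall t m, ('X - t%:P) ^+ m %| p -> ('X - t%:P) ^+ m %| q) -> p %| q.
Proof.
elim/ltn_ind: (size p) {-2}p (erefl (size p)) q => {p} N IH p sp q nzp ord.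
have [le1|gt1] := leqP (size p) 1.
  have -> : p = (p`_0)%:P by apply: size1_polyC.
  rewrite -alg_polyC dvdpZl ?dvd1p //.
  by apply: contraNneq nzp => p0; rewrite [p]size1_polyC // p0.
have [|t] := closed_rootP p _; first by rewrite neq_ltn gt1 orbT.
rewrite -dvdp_XsubCl => /dvdpP[p1 pE].
have /dvdpP[q1 qE] : ('X - t%:P) %| q by rewrite -[_ - _]expr1 ord // expr1 pE dvdp_mull.
have nz1 : p1 != 0 by apply: contraNneq nzp => p10; rewrite pE p10 mul0r.
have nzt := polyXsubC_eq0 t.
rewrite pE qE dvdp_mul2r ?nzt //.
apply: (IH (size p1)) => // [|s m].
  by rewrite -sp pE size_Mmonic ?monicXsubC // size_XsubC addn2 /= ltnSn.
have [->|nst] := eqVneq s t.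
  move=> d1; rewrite -(@dvdp_mul2r _ ('X - t%:P)) ?nzt // -exprSr -qE ord //.
  by rewrite exprSr pE dvdp_mul.
move=> d1; have : ('X - s%:P) ^+ m %| q by rewrite ord // pE dvdp_mulr.
rewrite qE Gauss_dvdpl //; apply: coprimep_expl.
by rewrite coprimep_XsubC root_XsubC eq_sym.
Qed.

(** * Generic points and directions *)

Section Genericity.
Variables (n : nat) (k : fieldType).
Hypothesis chark : forall m, m.+1%:R != 0 :> k.
Implicit Types (p q : {mpoly k[n]}) (M : 'M[k]_n) (a b : 'cV[k]_n).

Lemma poly_vanishing (q : {poly k}) : (forall t, q.[t] = 0) -> q = 0.
Proof.
move=> q0; apply/eqP; apply: contraT => nq.
have inj : injective (fun i : nat => i%:R : k).
  move=> i j; wlog leij : i j / (i <= j)%N.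
    by move=> H e; case/orP: (leq_total i j) => /H // -> //.
  move=> e; have /eqP := e; rewrite eq_sym -subr_eq0 -natrB //.
  case: (j - i)%N (subnKC leij) => [|d] ijE; first by rewrite -ijE addn0.
  by rewrite (negPf (chark d)).
have := max_poly_roots nq (rs := [seq i%:R | i <- iota 0 (size q)]).
rewrite size_map size_iota ltnn => -> //.
  by apply/allP => x _; rewrite /root q0.
by rewrite map_inj_uniq // iota_uniq.
Qed.

Lemma deriv_line_eval a b p :
  (line_eval a b p)^`() = \sum_j b j 0 *: line_eval a b p^`M(j).
Proof.
elim/mpoly_gen_ind: p => [c|i|p q IHp IHq|p q IHp IHq].
- by rewrite line_evalC derivC big1 // => j _; rewrite mderivC rmorph0 scaler0.
- rewrite line_evalXU derivD derivC derivZ derivX add0r (bigD1 i) //= big1 => [|j nj].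
    by rewrite mderivXU eqxx rmorph1 addr0.
  by rewrite mderivXU eq_sym (negPf nj) rmorph0 scaler0.
- rewrite rmorphD derivD IHp IHq -big_split; apply: eq_bigr => j _ /=.
  by rewrite mderivD rmorphD scalerDr.
rewrite rmorphM derivM IHp IHq mulr_suml mulr_sumr -big_split; apply: eq_bigr => j _ /=.
by rewrite mderivM rmorphD !rmorphM /= scalerDr -scalerAl -scalerAr.
Qed.

Lemma mcoeff0_meval p : p@_0%MM = p.@[pt 0].
Proof.
elim/mpoly_gen_ind: p => [c|i|p q IHp IHq|p q IHp IHq].
- by rewrite mcoeffC eqxx mulr1 mevalC.
- by rewrite mcoeffX mnm1_eq0 mevalXU /pt mxE.
- by rewrite mcoeffD mevalD IHp IHq.
- by rewrite rmorphM mevalM /= IHp IHq.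
Qed.

(** Along coordinate lines the partial derivatives vanish everywhere as well. Each coefficient,
    times a positive integer, is thus a lower coefficient of a derivative, down to the constant
    term. *)
Lemma mpoly_vanishing p : (forall a, p.@[pt a] = 0) -> p = 0.
Proof.
move=> p0; apply/mpolyP => m; rewrite mcoeff0.
elim: {m}(mdeg m) {-2}m (erefl (mdeg m)) p p0 => [|d IH] m dm p p0.
  move/eqP: dm; rewrite mdeg_eq0 => /eqP ->.
  by rewrite mcoeff0_meval.
have [i mi] : exists i, (0 < m i)%N.
  apply/existsP; apply: contraT; rewrite negb_exists => /forallP m0.
  have : mdeg m = 0%N by rewrite mdegE big1 // => i _; apply/eqP; rewrite -leqn0 leqNgt m0.
  by rewrite dm.
have dp0 a : (p^`M(i)).@[pt a] = 0.
  have l0 : line_eval a (delta_mx i 0) p = 0.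
    by apply: poly_vanishing => t; rewrite horner_line_eval p0.
  have := deriv_line_eval a (delta_mx i 0) p; rewrite l0 deriv0.
  rewrite (bigD1 i) //= big1 => [|j nj]; last by rewrite mxE (negPf nj) scale0r.
  rewrite mxE !eqxx scale1r addr0 => /(congr1 (horner^~ 0)).
  by rewrite horner0 horner_line_eval scale0r addr0.
have mE : m = (m - U_(i) + U_(i))%MM by rewrite submK // lep1mP -lt0n.
have dm' : mdeg (m - U_(i)) = d.
  by move: dm; rewrite {1}mE mdegD mdeg1 addn1 => -[].
have := IH _ dm' _ dp0; rewrite mcoeff_deriv -mE => /eqP.
by rewrite -mulr_natr mulf_eq0 (negPf (chark _)) orbF => /eqP.
Qed.

Lemma mpoly_nonvanishing p : p != 0 -> exists a, p.@[pt a] != 0.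
Proof.
move=> np.
have [//|noa] := boolp.pselect (exists a, p.@[pt a] != 0).
case/eqP: np; apply: mpoly_vanishing => a; apply/eqP; apply: contraT => na.
by case: noa; exists a.
Qed.

Lemma meval_lin_form (r : 'rV[k]_n) a : (lin_form r).@[pt a] = (r *m a) 0 0.
Proof.
rewrite /lin_form raddf_sum mxE; apply: eq_bigr => j _.
by rewrite /= mevalZ mevalXU.
Qed.

Lemma lin_form_neq0 (r : 'rV[k]_n) : r != 0 -> lin_form r != 0.
Proof.
apply: contraNneq => r0; apply/eqP/rowP => j; rewrite mxE.
by have := mderiv_lin_form r j; rewrite r0 mderiv0 => /esym/eqP; rewrite mpolyC_eq0 => /eqP.
Qed.

(** [q] is a product of linear forms, one nonzero row for each nonzero matrix. *)
Lemma generic_direction (Ms : seq 'M[k]_n) : exists2 q, q != 0 &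
  forall b, q.@[pt b] != 0 -> {in Ms, forall M, M != 0 -> M *m b != 0}.
Proof.
elim: Ms => [|M Ms [q nq qP]]; first by exists 1; rewrite ?oner_eq0.
have [->|nM] := eqVneq M 0.
  by exists q => // b /qP qb M'; rewrite inE => /predU1P[->|/qb]; rewrite ?eqxx.
have [i nMi] : exists i, row i M != 0.
  apply/existsP; apply: contraR nM; rewrite negb_exists => /forallP M0.
  by apply/eqP/row_matrixP => i; rewrite row0; apply/eqP; rewrite -[_ == _]negbK M0.
exists (lin_form (row i M) * q) => [|b]; first by rewrite mulf_neq0 ?lin_form_neq0.
rewrite mevalM mulf_eq0 negb_or meval_lin_form => /andP[nb /qP qb] M'.
rewrite inE => /predU1P[->|/qb //] _.
by apply: contraNneq nb => Mb; rewrite -row_mul Mb row0 mxE.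
Qed.

Variables (C : fieldType) (iota : {rmorphism k -> C}).

Definition rank_le1 M := exists (c : 'cV[k]_n) (r : 'rV[k]_n), M = c *m r.

(** If M(a + t b) = 0 then Ma and Mb are proportional, and their 2 by 2 minors vanish whatever [t]
    in [C] is. These minors are linear forms in [a] over [k]; if all those through a nonzero entry
    [j] of Mb are identically 0, then [M] is Mb times a multiple of its row [j]. *)
Lemma generic_base (Ms : seq 'M[k]_n) b : {in Ms, forall M, M != 0 -> M *m b != 0} ->
  exists2 q, q != 0 & forall a, q.@[pt a] != 0 -> {in Ms, forall M t,
    map_mx iota M *m (map_mx iota a + t *: map_mx iota b) = 0 -> rank_le1 M}.
Proof.
elim: Ms => [|M Ms IH] gb; first by exists 1; rewrite ?oner_eq0.
have [M' M'Ms|q nq qP] := IH; first by apply: gb; rewrite inE M'Ms orbT.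
have done_if : rank_le1 M -> exists2 q, q != 0 & forall a, q.@[pt a] != 0 ->
    {in M :: Ms, forall M t,
    map_mx iota M *m (map_mx iota a + t *: map_mx iota b) = 0 -> rank_le1 M}.
  move=> rM; exists q => // a qa M' M'Ms t.
  by move: M'Ms; rewrite inE => /predU1P[-> _ //|M'Ms]; apply: qP.
have [M0|nM] := eqVneq M 0; first by apply: done_if; exists 0, 0; rewrite mul0mx.
have nMb := gb M (mem_head _ _) nM.
have [j nj] : exists j, (M *m b) j 0 != 0.
  apply/existsP; apply: contraR nMb; rewrite negb_exists => /forallP M0.
  by apply/eqP/colP => i; rewrite [RHS]mxE; apply/eqP; rewrite -[_ == _]negbK M0.
pose r i : 'rV_n := (M *m b) j 0 *: row i M - (M *m b) i 0 *: row j M.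
have [/existsP[i nri]|] := boolP [exists i, r i != 0]; last first.
  rewrite negb_exists => /forallP r0; apply: done_if.
  exists (((M *m b) j 0)^-1 *: (M *m b)), (row j M); apply/row_matrixP => i.
  have := r0 i; rewrite negbK subr_eq0 => /eqP ri.
  apply/rowP => l; have := congr1 (fun x : 'rV_n => x 0 l) ri; rewrite !mxE big_ord1 !mxE => e.
  by rewrite -mulrA -e mulKf //; move: nj; rewrite mxE.
exists (lin_form (r i) * q) => [|a]; first by rewrite mulf_neq0 ?lin_form_neq0.
rewrite mevalM mulf_eq0 negb_or meval_lin_form => /andP[na qa] M' M'Ms t.
move: M'Ms; rewrite inE => /predU1P[-> Mv|M'Ms]; last exact: qP.
case/eqP: na; apply: (fmorph_inj iota); rewrite rmorph0.
have E l : iota ((M *m a) l 0) = - t * iota ((M *m b) l 0).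
  have := congr1 (fun x : 'cV_n => x l 0) Mv.
  rewrite mulmxDr -scalemxAr -!map_mxM !mxE => /eqP; rewrite addr_eq0 mulNr => /eqP -> //.
have -> : (r i *m a) 0 0 = (M *m b) j 0 * (M *m a) i 0 - (M *m b) i 0 * (M *m a) j 0.
  by rewrite mulmxBl -!scalemxAl -!row_mul !mxE.
by rewrite rmorphB !rmorphM !E; ring.
Qed.

End Genericity.

(** * Extension of scalars *)

Section BaseChange.
Variables (n : nat) (k C : fieldType) (iota : {rmorphism k -> C}).
Implicit Types (p q : {mpoly k[n]}) (s : 'M[k]_n).

Lemma map_mpoly_comp_mpoly m (q : {mpoly k[m]}) (f : m.-tuple {mpoly k[n]}) :
  map_mpoly iota (q \mPo f) = map_mpoly iota q \mPo map_tuple (map_mpoly iota) f.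
Proof.
elim/mpoly_gen_ind: q => [c|i|p q IHp IHq|p q IHp IHq].
- by rewrite comp_mpolyC !map_mpolyC comp_mpolyC.
- by rewrite map_mpolyX !comp_mpolyXU -!tnth_nth tnth_map.
- by rewrite !rmorphD /= IHp IHq.
- by rewrite !rmorphM /= IHp IHq.
Qed.

Lemma map_poly_act s p :
  map_mpoly iota (poly_act s p) = poly_act (map_mx iota s) (map_mpoly iota p).
Proof.
rewrite /poly_act map_mpoly_comp_mpoly; congr (_ \mPo _); apply: eq_from_tnth => i.
rewrite tnth_map !tnth_mktuple rmorph_sum; apply: eq_bigr => j _.
by rewrite /= map_mpolyZ map_mpolyX -map_invmx mxE.
Qed.

Lemma mderiv_map_mpoly p j : (map_mpoly iota p)^`M(j) = map_mpoly iota p^`M(j).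
Proof.
apply/mpolyP => m; rewrite mcoeff_deriv !mcoeff_map_mpoly mcoeff_deriv.
by rewrite raddfMn.
Qed.

(** Moving the base point to a + t b shifts the parameter by [t], which need not come from [k]. *)
Lemma line_eval_base_change (a b : 'cV[k]_n) t p :
  line_eval (map_mx iota a + t *: map_mx iota b) (map_mx iota b) (map_mpoly iota p) =
  map_poly iota (line_eval a b p) \Po ('X + t%:P).
Proof.
elim/mpoly_gen_ind: p => [c|i|p q IHp IHq|p q IHp IHq].
- by rewrite map_mpolyC !line_evalC map_polyC comp_polyC.
- rewrite map_mpolyX !line_evalXU rmorphD /= map_polyC map_polyZ map_polyX !mxE.
  rewrite comp_polyD comp_polyC comp_polyZ comp_polyX polyCD polyCM -!mul_polyC; ring.
- by rewrite !rmorphD /= IHp IHq.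
- by rewrite !rmorphM /= IHp IHq.
Qed.

Lemma map_matrix_group (G : seq 'M[k]_n) :
  matrix_group G -> matrix_group [seq map_mx iota s | s <- G].
Proof.
case=> uG unitG G1 GM; split.
- by rewrite map_inj_uniq //; exact: map_mx_inj.
- by move=> _ /mapP[s sG ->]; rewrite map_unitmx unitG.
- by apply/mapP; exists 1%:M; rewrite ?map_mx1.
move=> _ _ /mapP[s sG ->] /mapP[t tG ->].
by apply/mapP; exists (s *m t); rewrite ?GM ?map_mxM.
Qed.

Lemma map_average (G : seq 'M[k]_n) :
  average [seq map_mx iota s | s <- G] = map_mx iota (average G).
Proof.
rewrite /average size_map big_map map_mxZ fmorphV rmorph_nat; congr (_ *: _).
by rewrite raddf_sum.
Qed.

End BaseChange.

Lemma reynolds_invariant n (k : fieldType) (G : seq 'M[k]_n) (p : {mpoly k[n]}) :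
  matrix_group G ->
  {in G, forall s, poly_act s (\sum_(t <- G) poly_act t p) = \sum_(t <- G) poly_act t p}.
Proof.
move=> gG s sG; have [_ uG _ _] := gG.
rewrite rmorph_sum /= -[RHS](perm_big _ (perm_lmul gG sG)) big_map.
by apply: eq_big_seq => t tG /=; rewrite poly_actM ?uG.
Qed.

(** * From divisibility on generic lines to divisibility in k[x] *)

Section LineExpansion.
Variables (n : nat) (k : fieldType) (b : 'cV[k]_n).
Local Notation MP := {mpoly k[n]}.
Implicit Types (p q : MP).

(** The expansion of p(x + T b) in powers of T, with coefficients in [k[x]]. *)
Definition translate p : {poly MP} :=
  mmap (polyC \o @mpolyC n k) (fun i => ('X_i)%:P + (b i 0)%:MP *: 'X) p.

HB.instance Definition _ := GRing.RMorphism.copy translate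
  (mmap (polyC \o @mpolyC n k) (fun i => ('X_i)%:P + (b i 0)%:MP *: 'X)).

Lemma translateZ c p : translate (c *: p) = c%:MP *: translate p.
Proof. by rewrite /translate mmapZ -mul_polyC. Qed.

(** [u] has degree at most [d] and coefficient [c] at ['X^d]. Allowing [c = 0] makes the notion
    stable under sums and products. *)
Definition has_top d (u : {poly MP}) (c : MP) := (size (u - c *: 'X^d)%R <= d)%N.

Lemma has_topM d e u v c c' : has_top d u c -> has_top e v c' ->
  has_top (d + e) (u * v) (c * c').
Proof.
rewrite /has_top => hu hv.
set u' := u - _ in hu; set v' := v - _ in hv.
have -> : u * v - (c * c') *: 'X^(d + e) = c *: 'X^d * v' + u' * (c' *: 'X^e) + u' * v'.
  rewrite /u' /v' exprD -!mul_polyC polyCM; ring.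
have szX (a : MP) N : (size (a *: 'X^N)%R <= N.+1)%N.
  by apply: leq_trans (size_scale_leq _ _) _; rewrite size_polyXn.
have Hm (x y : {poly MP}) x0 y0 : (size x <= x0)%N -> (size y <= y0)%N ->
    (size (x * y)%R <= (x0 + y0).-1)%N.
  move=> hx hy; apply: leq_trans (size_polyMleq _ _) _.
  by rewrite -!subn1 leq_sub2r // leq_add.
do 2?[apply: leq_trans (size_polyD _ _) _; rewrite geq_max; apply/andP; split].
- exact: (Hm _ _ d.+1 e).
- by apply: leq_trans (Hm _ _ d e.+1 _ _) _ => //; rewrite addnS.
- by apply: leq_trans (Hm _ _ d e hu hv) _; rewrite leq_pred.
Qed.

Lemma has_top_translateX m : has_top (mdeg m) (translate 'X_[m]) ('X_[m].@[pt b])%:MP.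
Proof.
pose P (d : nat) (u : {poly MP}) (c : MP) := has_top d u c.
rewrite /translate mmapX mevalX mdegE rmorph_prod /mmap1 /=.
apply: (big_ind3 P) => [|d1 u1 c1 d2 u2 c2|i _].
- by rewrite /P /has_top expr0 scale1r subrr size_poly0.
- exact: has_topM.
rewrite /P; elim: (m i) => [|e IH].
  by rewrite /has_top !expr0 scale1r subrr size_poly0.
rewrite !exprS mpolyCM -addn1 addnC; apply: has_topM => //.
by rewrite /has_top expr1 addrK size_polyC; case: eqP.
Qed.

Lemma has_topD d u v c c' : has_top d u c -> has_top d v c' -> has_top d (u + v) (c + c').
Proof.
rewrite /has_top scalerDl opprD addrACA => hu hv.
by apply: leq_trans (size_polyD _ _) _; rewrite geq_max hu.
Qed.

Lemma has_topZ d u c c' : has_top d u c -> has_top d (c' *: u) (c' * c).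
Proof.
rewrite /has_top -scalerA -scalerBr; apply: leq_trans; exact: size_scale_leq.
Qed.

Lemma has_top_translate d p : p \is d.-homog -> has_top d (translate p) (p.@[pt b])%:MP.
Proof.
move=> /dhomogP hp.
have -> : translate p = \sum_(m <- msupp p) (p@_m)%:MP *: translate 'X_[m].
  by rewrite {1}[p]mpolyE rmorph_sum; apply: eq_bigr => m _; exact: translateZ.
have -> : (p.@[pt b])%:MP = \sum_(m <- msupp p) (p@_m)%:MP * ('X_[m].@[pt b])%:MP :> MP.
  have -> : p.@[pt b] = \sum_(m <- msupp p) p@_m * 'X_[m].@[pt b].
    by rewrite {1}[p]mpolyE raddf_sum; apply: eq_bigr => m _; exact: mevalZ.
  by rewrite rmorph_sum; apply: eq_bigr => m _; exact: mpolyCM.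
rewrite !big_seq; apply: (big_ind2 (has_top d)) => [|u c v c'|m mp].
- by rewrite /has_top scale0r subrr size_poly0.
- exact: has_topD.
by have := has_top_translateX m; rewrite (hp m mp); exact: has_topZ.
Qed.

Lemma size_translate d p : p \is d.-homog -> p.@[pt b] != 0 ->
  size (translate p) = d.+1 /\ lead_coef (translate p) = (p.@[pt b])%:MP.
Proof.
move=> hp nz; have ht := has_top_translate hp.
set c := (p.@[pt b])%:MP in ht *; have nc : c != 0 by rewrite mpolyC_eq0.
have E : translate p = c *: 'X^d + (translate p - c *: 'X^d) by rewrite addrC subrK.
have sz : size (c *: 'X^d) = d.+1 by rewrite size_scale // size_polyXn.
split; rewrite E; first by rewrite size_polyDl ?sz.
by rewrite lead_coefDl ?sz // lead_coefZ lead_coefXn mulr1.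
Qed.

Lemma map_translate a p : map_poly (meval (pt a)) (translate p) = line_eval a b p.
Proof.
rewrite /translate (rmorph_mmap _ _ (h' := GRing.RMorphism.clone _ _ (@polyC k) _)) => [|c].
  apply: mmap_ext => i; rewrite /= rmorphD /= map_polyC /= mevalXU map_polyZ map_polyX /=.
  by rewrite mevalC.
by rewrite /= map_polyC /= mevalC.
Qed.

Lemma translate0 p : (translate p).[0] = p.
Proof.
rewrite -[LHS]/(horner_eval 0 (translate p)) /translate.
rewrite (rmorph_mmap _ _ (h' := GRing.RMorphism.clone _ _ (@mpolyC n k) _)) => [|c]; last first.
  by rewrite /= /horner_eval hornerC.
rewrite -[RHS]comp_mpoly_id /comp_mpoly; apply: mmap_ext => i.
by rewrite tnth_mktuple /= /horner_eval !hornerE.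
Qed.

(** The leading coefficient of [translate D] is the nonzero constant D(b), so one can divide by it
    over [k[x]]. The remainder vanishes on every line with g(a) nonzero, so its coefficients times
    [g] vanish everywhere; T = 0 then gives the quotient in [k[x]]. *)
Lemma dvdp_of_lines (D p g : MP) d : (forall m, m.+1%:R != 0 :> k) ->
  D \is d.-homog -> D.@[pt b] != 0 -> g != 0 ->
  (forall a, g.@[pt a] != 0 -> line_eval a b D %| line_eval a b p) ->
  exists q, p = q * D.
Proof.
move=> chark hD nD ng dvd_lines.
have [sD lD] := size_translate hD nD.
have uD : lead_coef (translate D) \is a GRing.unit.
  by rewrite lD; apply: (rmorph_unit (@mpolyC n k)); rewrite unitfE.
have divE := Pdiv.IdomainUnit.divp_eq uD (translate p).
set Q := (_ %/ _) in divE; set S := (_ %% _) in divE.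
have sS : (size S < d.+1)%N.
  by rewrite -sD ltn_modp -size_poly_eq0 sD.
suff S0 : S = 0.
  exists Q.[0]; rewrite -[LHS]translate0 divE S0 addr0 hornerM translate0 //.
apply/polyP => i; rewrite coef0.
have : S`_i * g = 0.
  apply: (mpoly_vanishing chark) => a; rewrite mevalM.
  have [->|na] := eqVneq g.@[pt a] 0; first by rewrite mulr0.
  have := dvd_lines a na; rewrite -(map_translate a p) divE rmorphD rmorphM /=.
  rewrite map_translate dvdp_addr ?dvdp_mull //.
  have szD : size (line_eval a b D) = d.+1.
    rewrite -map_translate size_map_poly_id0 ?sD // lD.
    by rewrite /= mevalC.
  move=> dvdS; have S0 : map_poly (meval (pt a)) S = 0.
    apply/eqP; apply: contraT => nS; have := dvdp_leq nS dvdS.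
    by rewrite szD leqNgt (leq_ltn_trans (size_poly _ _)).
  have := congr1 (fun u : {poly k} => u`_i) S0; rewrite coef_map coef0 /= => ->.
  by rewrite mul0r.
by move/eqP; rewrite mulf_eq0 (negPf ng) orbF => /eqP.
Qed.

End LineExpansion.

(** * The Jacobian and the det-semi-invariants *)

Section SemiInvariants.
Variables (n : nat) (k : fieldType) (C : closedFieldType) (iota : {rmorphism k -> C}).
Hypothesis charC : forall m, m.+1%:R != 0 :> C.
Variables (G : seq 'M[k]_n) (f : n.-tuple {mpoly k[n]}).
Hypothesis gG : matrix_group G.
Hypothesis inv_f : forall p, {in G, forall s, poly_act s p = p} -> exists q, p = q \mPo f.

Definition jacobian : {mpoly k[n]} := \det (\matrix_(i, j) (tnth f i)^`M(j)).

Let chark m : m.+1%:R != 0 :> k.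
Proof. by have := charC m; rewrite -(rmorph_nat iota) fmorph_eq0. Qed.

Let GC := [seq map_mx iota s | s <- G].
Let fC := map_tuple (map_mpoly iota) f.
Let gGC : matrix_group GC := map_matrix_group iota gG.

(* The line a + t b of [semi_invariant_dvd] is chosen to meet the kernel of such
   a matrix only when the rank of the matrix is at most 1. *)
Let Ms : seq 'M[k]_n :=
  [seq 1%:M - average (mask (tval m) G) | m <- enum {: (size G).-tuple bool}].

(** Monomials are defined over [k], so their averages are covered by [inv_f]; linearity over [C]
    does the rest. *)
Lemma reynolds_base_change p : exists Q, \sum_(s <- GC) poly_act s p = Q \mPo fC.
Proof.
rewrite [p]mpolyE; under eq_bigr => s _ do rewrite rmorph_sum.
rewrite exchange_big /=.
apply: (big_ind (fun u => exists Q, u = Q \mPo fC)) => [|u v [Q ->] [Q' ->]|m _].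
- by exists 0; rewrite comp_mpoly0.
- by exists (Q + Q'); rewrite comp_mpolyD.
have [Q QE] := inv_f (reynolds_invariant 'X_[m] gG).
exists (p@_m *: map_mpoly iota Q); rewrite comp_mpolyZ -map_mpoly_comp_mpoly -QE.
rewrite rmorph_sum /= scaler_sumr big_map; apply: eq_bigr => s _ /=.
by rewrite map_poly_act map_mpolyX linearZ.
Qed.

Lemma jacobian_base_change :
  \det (\matrix_(i, j) (tnth fC i)^`M(j)) = map_mpoly iota jacobian.
Proof.
rewrite /jacobian -det_map_mx; congr (\det _); apply/matrixP => i j.
by rewrite !mxE tnth_map mderiv_map_mpoly.
Qed.

(** A stabiliser over [C] is a sublist of the group, hence given by a mask. So [Ms] contains the
    matrix for every [v], and genericity can be imposed before [v] is known. *)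
Lemma stabiliser_average v : exists2 M, M \in Ms &
  1%:M - average (stabiliser GC v) = map_mx iota M /\ map_mx iota M *m v = 0.
Proof.
pose m := [seq map_mx iota s *m v == v | s <- G].
have sm : size m == size G by rewrite size_map.
have stE : stabiliser GC v = [seq map_mx iota s | s <- mask m G].
  by rewrite /stabiliser filter_map filter_mask.
have E : 1%:M - average (stabiliser GC v) = map_mx iota (1%:M - average (mask m G)).
  by rewrite stE map_average map_mxB map_mx1.
exists (1%:M - average (mask m G)).
  by apply/mapP; exists (Tuple sm); rewrite ?mem_enum.
split=> //; rewrite -E mulmxBl mul1mx.
have [_ _ one_in _] := stabiliser_group v gGC.
rewrite /average -scalemxAl mulmx_suml big_seq.
under eq_bigr => s sG.
  have -> : s *m v = v by move: sG; rewrite mem_filter => /andP[/eqP].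
  over.
rewrite -big_seq big_const_seq count_predT iter_addr_0 -scaler_nat scalerA.
case: (stabiliser GC v) one_in => [//|s r] _ /=.
by rewrite mulVf ?charC // scale1r subrr.
Qed.

(** At a point outside the kernels of the nonzero members of [Ms] the stabiliser average is the
    identity. There [jacobian_order] applies, even with direction 0, and excludes the zero
    polynomial, which every power of ['X] divides. *)
Lemma jacobian_neq0 : jacobian != 0.
Proof.
have [q nq qP] := generic_direction Ms.
have [b qb] := mpoly_nonvanishing chark nq.
have [M MMs [avgM Mv]] := stabiliser_average (map_mx iota b).
have M0 : M = 0.
  apply/eqP; apply: contraT => nM; have := qP b qb M MMs nM.
  by rewrite -(map_mx_eq0 iota) map_mxM Mv eqxx.
have avg0 : 1%:M - average (stabiliser GC (map_mx iota b)) = 0 *m (0 : 'rV_n).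
  by rewrite avgM M0 map_mx0 mul0mx.
have genb : 1%:M - average (stabiliser GC (map_mx iota b)) != 0 ->
    (1%:M - average (stabiliser GC (map_mx iota b))) *m (0 : 'cV_n) != 0.
  by rewrite avg0 mul0mx eqxx.
have := jacobian_order charC gGC avg0 genb reynolds_base_change; apply: contraNneq => J0.
by rewrite jacobian_base_change J0 !rmorph0 dvdp0.
Qed.

Hypothesis homog_f : forall i, exists d, tnth f i \is d.-homog.

Lemma mderiv_homog d (p : {mpoly k[n]}) j : p \is d.-homog -> p^`M(j) \is d.-1.-homog.
Proof.
move=> hp; apply/dhomogP => m; rewrite mcoeff_msupp mcoeff_deriv => nz.
have mp : (m + U_(j))%MM \in msupp p.
  by rewrite mcoeff_msupp; apply: contraNneq nz => ->; rewrite mul0rn.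
by have /dhomogP/(_ _ mp) /= <- := hp; rewrite mdegD mdeg1 addn1.
Qed.

Lemma det_homog (d : 'I_n -> nat) (M : 'M[{mpoly k[n]}]_n) :
  (forall i j, M i j \is (d i).-homog) -> \det M \is (\sum_i d i)%N.-homog.
Proof.
move=> hM; apply: rpred_sum => s _; rewrite -signr_odd mulr_sign.
have h : \prod_i M i (s i) \is (\sum_i d i)%N.-homog.
  apply: (big_ind2 (fun (u : {mpoly k[n]}) e => u \is e.-homog)) => //.
  - exact: dhomog1.
  - by move=> u e u' e'; apply: dhomogM.
by case: ifP => _; rewrite ?rpredN.
Qed.

Lemma jacobian_homog (d : 'I_n -> nat) : (forall i, tnth f i \is (d i).-homog) ->
  jacobian \is (\sum_i (d i).-1)%N.-homog.
Proof. by move=> hd; apply: det_homog => i j; rewrite mxE mderiv_homog. Qed.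

Lemma semi_invariant_dvd p : {in G, forall s, poly_act s p = \det s *: p} ->
  exists q, p = q * jacobian.
Proof.
move=> semi_p; have [d hd] := fin_all_exists homog_f.
(* The direction comes before the base point, since the conditions on [a] depend on [b]. *)
have [q1 nq1 q1P] := generic_direction Ms.
have [b] := mpoly_nonvanishing chark (mulf_neq0 nq1 jacobian_neq0).
rewrite mevalM mulf_eq0 negb_or => /andP[/q1P gb Jb].
have [q2 nq2 q2P] := generic_base iota gb.
apply: (dvdp_of_lines chark (jacobian_homog hd) Jb (mulf_neq0 nq2 jacobian_neq0)) => a.
rewrite mevalM mulf_eq0 negb_or => /andP[/q2P ga Ja].
rewrite -(dvdp_map iota); apply: dvdp_by_order.
  rewrite map_poly_eq0; apply: contraNneq Ja => l0.
  by have := horner_line_eval a b jacobian 0; rewrite l0 horner0 scale0r addr0 => <-.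
move=> t m; pose v := map_mx iota a + t *: map_mx iota b.
(* The order at the root [t] is the order at parameter 0 on the line based at [v]. *)
have shift u : ('X - t%:P) ^+ m %| map_poly iota (line_eval a b u) =
    ('X^m %| line_eval v (map_mx iota b) (map_mpoly iota u)).
  rewrite /v line_eval_base_change; apply/idP/idP => [/(dvdp_comp_poly ('X + t%:P))|].
    by rewrite rmorphXn /= comp_polyB comp_polyX comp_polyC addrK.
  move/(dvdp_comp_poly ('X - t%:P)); rewrite -comp_polyA comp_polyD comp_polyX comp_polyC subrK.
  by rewrite comp_polyXr rmorphXn /= comp_polyX.
rewrite !shift => dvdJ.
have [M MMs [avgM Mv]] := stabiliser_average v.
have [c [r McR]] := ga M MMs t Mv.
have avgE : 1%:M - average (stabiliser GC v) = map_mx iota c *m map_mx iota r.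
  by rewrite avgM McR map_mxM.
have genb : 1%:M - average (stabiliser GC v) != 0 ->
    (1%:M - average (stabiliser GC v)) *m map_mx iota b != 0.
  by rewrite avgM -map_mxM !map_mx_eq0; apply: gb.
have ordJ := jacobian_order charC gGC avgE genb reynolds_base_change.
have ordp := semi_invariant_order charC gGC avgE genb.
have lem : (m <= (size (stabiliser GC v)).-1)%N.
  rewrite leqNgt; apply: contra ordJ => ltm; rewrite jacobian_base_change.
  by apply: dvdp_trans dvdJ; rewrite dvdp_exp2l.
apply: dvdp_trans (ordp _ _); first by rewrite dvdp_exp2l.
move=> s; rewrite mem_filter => /andP[_ /mapP[s0 s0G ->]].
by rewrite -map_poly_act semi_p // map_mpolyZ det_map_mx.
Qed.

End SemiInvariants.

(** * The basis *)

Lemma odot_poly n (k : comNzRingType) (cj : {rmorphism k -> k}) (u : superpoly n k) h :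
  odot cj u (sp_poly h) = [ffun J => diff_op cj (u J) h].
Proof.
have foldE (r : seq 'I_n) g :
    foldr (fun i h => sp_gen k i * h) g r = \prod_(i <- r) sp_gen k i * g.
  by elim: r => [|i r IH] /=; rewrite ?big_nil ?mul1r // big_cons IH mulrA.
have coordE (I J : {set 'I_n}) :
    foldr (fun i h => sp_gen k i * h) (sp_poly h) (enum I) J = h *+ (J == I).
  rewrite foldE -(prod_set_enum (sp_gen k)) sp_prod_gen -sp_poly_comm sp_polyM ffunE.
  by rewrite mulr_natr.
apply/ffunP => J; rewrite /odot sum_ffunE ffunE (bigD1 J) //= [X in _ + X]big1 ?addr0.
  by rewrite sum_ffunE; apply: eq_bigr => m _; rewrite !ffunE coordE eqxx.
move=> I nI; rewrite sum_ffunE big1 // => m _.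
by rewrite !ffunE coordE eq_sym (negPf nI) raddf0 scaler0.
Qed.

Lemma prod_linear_homog n (k : comNzRingType) (c : 'I_n -> 'I_n -> {mpoly k[n]})
    (e : 'I_n -> nat) (I J : {set 'I_n}) : (forall i j, c i j \is (e i).-homog) ->
  (\prod_(i in I) sp_linear (c i)) J \is (\sum_(i in I) e i)%N.-homog.
Proof.
move=> hc; elim/set_min_ind: I J => [|I i iI min_i IH] J.
  by rewrite !big_set0 sp_oneE; case: eqP => _; rewrite ?dhomog1 ?dhomog0.
rewrite (prod_set_min _ iI min_i) (big_setD1 i iI) /= mulr_suml sum_ffunE.
apply: rpred_sum => j _; rewrite -mulrA sp_polyM sp_genE.
case: ifP => _; last by rewrite mulr0 dhomog0.
apply: dhomogM => //.
have -> : (-1) ^+ inversions [set j] (J :\ j) * (\prod_(x in I :\ i) sp_linear (c x)) (J :\ j) =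
   (-1) ^+ inversions [set j] (J :\ j) *: (\prod_(x in I :\ i) sp_linear (c x)) (J :\ j).
  by rewrite -mul_mpolyC rmorphXn rmorphN1.
exact: dhomogZ.
Qed.

Lemma diff_op_homog_coef n (k : comNzRingType) (cj : {rmorphism k -> k}) (p h : {mpoly k[n]})
    (d e : nat) (m : 'X_{1..n}) : p \is e.-homog -> h \is d.-homog -> (mdeg m + e)%N != d ->
  (diff_op cj p h)@_m = 0.
Proof.
move=> /dhomogP hp hh ne; rewrite /diff_op raddf_sum big_seq big1 // => m' m'p /=.
have ne' : mdeg (m' + m) != d by rewrite mdegD (hp m' m'p) addnC.
by rewrite mcoeffZ mcoeff_mderivm (dhomog_nemf_coeff hh ne') mul0rn mulr0.
Qed.

Section Basis.
Variables (n : nat) (k : fieldType) (C : closedFieldType) (iota : {rmorphism k -> C}).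
Hypothesis charC : forall m, m.+1%:R != 0 :> C.
Variable cj : {rmorphism k -> k}.
Hypothesis cjK : involutive cj.
Hypothesis posdef : forall (T : finType) (x : T -> k) (c : T -> nat),
  (forall t, 0 < c t)%N -> \sum_t cj (x t) * x t *+ c t = 0 -> forall t, x t = 0.
Variables (G : seq 'M[k]_n) (f : n.-tuple {mpoly k[n]}).
Hypothesis gG : matrix_group G.
Hypothesis unitary_G : {in G, forall s, forall i j, cj (invmx s i j) = s j i}.
Hypothesis homog_f : forall i, exists d, tnth f i \is d.-homog.
Hypothesis indep_f : forall q : {mpoly k[n]}, q \mPo f = 0 -> q = 0.
Hypothesis inv_f : forall p,
  {in G, forall s, poly_act s p = p} <-> exists q : {mpoly k[n]}, p = q \mPo f.

Local Notation Delta := (jacobian f).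
Local Notation c := (fun i j => (tnth f i)^`M(j)).
Local Notation df I := (\prod_(i in I) sp_linear (c i)).
Local Notation fpow a := (\prod_(i < n) tnth f i ^+ a i).

Let invP p : {in G, forall s, poly_act s p = p} -> exists q, p = q \mPo f := proj1 (inv_f p).
Let nzD : Delta != 0 := jacobian_neq0 iota charC gG invP.

(** The coordinates of df_I (.) (f^a Delta): by [odot_poly], each minor of the Jacobian matrix acts
    separately. *)
Definition basis_elt (Ia : {set 'I_n} * 'X_{1..n}) : superpoly n k :=
  [ffun J => diff_op cj (df Ia.1 J) (fpow Ia.2 * Delta)].

Lemma fpowE (a : 'X_{1..n}) : fpow a = 'X_[a] \mPo f.
Proof. by rewrite comp_mpolyX. Qed.

Lemma comp_fpow (q : {mpoly k[n]}) : q \mPo f = \sum_(a <- msupp q) q@_a *: fpow a.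
Proof. exact: comp_mpolyE. Qed.

Lemma poly_act_comp s q : s \in G -> poly_act s (q \mPo f) = q \mPo f.
Proof. by move=> sG; have [_ H] := inv_f (q \mPo f); apply: H sG; exists q. Qed.

Lemma poly_act_f s i : s \in G -> poly_act s (tnth f i) = tnth f i.
Proof.
move=> sG; have -> : tnth f i = 'X_i \mPo f by rewrite comp_mpolyXU -tnth_nth.
exact: poly_act_comp.
Qed.

Lemma theta_act_df s (I : {set 'I_n}) : s \in G -> theta_act s (df I) = df I.
Proof.
move=> sG; rewrite theta_act_prod; apply: eq_bigr => i _.
by rewrite -sp_d_poly theta_act_d poly_act_f.
Qed.

(** The top form df_1 ... df_n = Delta theta_1 ... theta_n is invariant, while theta_1 ... theta_n
    is multiplied by det(s^-1). *)
Lemma jacobian_semi_invariant s : s \in G -> poly_act s Delta = \det s *: Delta.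
Proof.
move=> sG; have [_ uG _ _] := gG; have us := uG s sG.
have prodE : \prod_i sp_linear (c i) = sp_poly Delta * \prod_i sp_gen k i.
  rewrite /jacobian -prod_lin; last exact: anticommuting_gen.
  by apply: eq_bigr => i _; apply: eq_bigr => j _; rewrite mxE.
have e : poly_act s Delta * (\det (invmx s))%:MP = Delta.
  have : theta_act s (\prod_i sp_linear (c i)) = \prod_i sp_linear (c i).
    rewrite theta_act_prod; apply: eq_bigr => i _.
    by rewrite -sp_d_poly theta_act_d poly_act_f.
  rewrite prodE /theta_act sp_substM; last exact: theta_frame_anticommuting.
  rewrite sp_subst_poly sp_subst_prod; last exact: theta_frame_anticommuting.
  under eq_bigr => i _ do rewrite sp_subst_gen.
  move/ffunP/(_ setT); rewrite !sp_polyM prod_gen_top mulr1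
    (prod_linear_top (fun i j => (invmx s i j)%:MP)).
  suff -> : \det (\matrix_(i, j) (invmx s i j)%:MP) = (\det (invmx s))%:MP_[n] by [].
  transitivity (\det (map_mx (@mpolyC n k) (invmx s))); last by rewrite det_map_mx.
  by congr (\det _); apply/matrixP => i j; rewrite !mxE.
rewrite -{2}e mulrC mul_mpolyC scalerA det_inv mulfV ?scale1r //.
by rewrite -unitfE -unitmxE.
Qed.

Lemma basis_elt_act s t : s \in G -> psi_act s (basis_elt t) = \det s *: basis_elt t.
Proof.
move=> sG; have [_ uG _ _] := gG.
apply: (psi_act_diff_op (uG s sG) (unitary_G sG) (theta_act_df _ sG)).
by rewrite fpowE rmorphM /= poly_act_comp // jacobian_semi_invariant // scalerAr.
Qed.

Lemma diff_op_comp_minor (I K : {set 'I_n}) h :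
  \sum_J diff_op cj (comp_minor c K J) (diff_op cj (df I J) h) =
  diff_op cj Delta h *+ (I == K).
Proof.
rewrite (eq_bigr (fun J => diff_op cj (df I J * comp_minor c K J) h)) => [|J _]; last first.
  by rewrite [RHS]diff_opM -!diff_opM mulrC.
rewrite -diff_op_suml laplace_expansion -/(jacobian f).
by case: eqP => _; rewrite ?mul1r ?mul0r ?diff_op0l.
Qed.

Lemma basis_elt_free (r : seq ({set 'I_n} * 'X_{1..n})) (x : {set 'I_n} * 'X_{1..n} -> k) :
  uniq r -> \sum_(t <- r) x t *: basis_elt t = 0 -> {in r, forall t, x t = 0}.
Proof.
move=> ur e [K a] tr.
(* The cofactors of [K] annihilate all terms with another first index, so one polynomial in [f]
   collects what survives. *)
pose q : {mpoly k[n]} := \sum_(t <- r | t.1 == K) x t *: 'X_[t.2].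
have e0 : diff_op cj Delta ((q \mPo f) * Delta) = 0.
  rewrite /q rmorph_sum mulr_suml raddf_sum /=.
  transitivity (\sum_J diff_op cj (comp_minor c K J) ((\sum_(t <- r) x t *: basis_elt t) J)).
    under [RHS]eq_bigr => J _ do rewrite sum_ffunE raddf_sum /=.
    rewrite [RHS]exchange_big [LHS]big_mkcond; apply: eq_bigr => t _ /=.
    under [RHS]eq_bigr => J _ do rewrite !ffunE diff_opZr.
    rewrite -scaler_sumr diff_op_comp_minor mulrb; case: eqP => _; last by rewrite scaler0.
    by rewrite comp_mpolyZ -scalerAl diff_opZr fpowE.
  by rewrite e big1 // => J _; rewrite ffunE raddf0.
have q0 : q = 0.
  apply: indep_f; apply/eqP; have /eqP := diff_op_inj posdef e0.
  by rewrite mulf_eq0 (negPf nzD) orbF.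
have := congr1 (mcoeff a) q0; rewrite mcoeff0 /q raddf_sum /=.
rewrite big_mkcond (bigD1_seq (K, a)) //= eqxx mcoeffZ mcoeffX eqxx mulr1.
rewrite big1_seq ?addr0 // => -[I b] /andP[nb _] /=; case: (I =P K) => // eIK.
rewrite mcoeffZ mcoeffX; case: eqP => [eba|_]; last by rewrite mulr0.
by rewrite eIK eba eqxx in nb.
Qed.

Lemma sp_dot_df_semi_invariant w (I : {set 'I_n}) :
  {in G, forall s, psi_act s w = \det s *: w} ->
  exists q : {mpoly k[n]}, sp_dot (df I) w = (q \mPo f) * Delta.
Proof.
move=> Ww; have [_ uG _ _] := gG.
have semi : {in G, forall s, poly_act s (sp_dot (df I) w) = \det s *: sp_dot (df I) w}.
  move=> s sG; rewrite -(sp_dot_act (uG s sG)) theta_act_df // Ww // sp_polyZ sp_dot_polyr.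
  exact: mul_mpolyC.
have [q qE] := semi_invariant_dvd iota charC gG invP homog_f semi.
have [Q QE] : exists Q, q = Q \mPo f.
  apply: invP => s sG; have := semi s sG.
  rewrite qE rmorphM /= jacobian_semi_invariant // -scalerAr => /eqP.
  have nds : \det s != 0 by rewrite -unitfE -unitmxE uG.
  rewrite -subr_eq0 -scalerBr scaler_eq0 (negPf nds) -mulrBl mulf_eq0 (negPf nzD) orbF.
  by rewrite subr_eq0 => /eqP.
by exists Q; rewrite qE QE.
Qed.

Lemma basis_elt_orthogonal w : {in G, forall s, psi_act s w = \det s *: w} ->
  (forall t, sp_fischer cj (basis_elt t) w = 0) -> w = 0.
Proof.
move=> Ww orth; apply: (sp_dot_prod_inj (c := c) nzD) => I.
have [q qE] := sp_dot_df_semi_invariant I Ww.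
(* By adjointness the minors pass from operators applied to f^a Delta to factors of the coordinates
   of [w], which add up to [sp_dot (df I) w]. *)
have orthI (a : 'X_{1..n}) : fischer cj ((q \mPo f) * Delta) (fpow a * Delta) = 0.
  rewrite -qE; have := congr1 cj (orth (I, a)); rewrite -sp_fischerC // rmorph0.
  apply: etrans.
  rewrite /sp_fischer /sp_dot.
  rewrite /fischer diff_op_suml raddf_sum; apply: eq_bigr => J _ /=.
  by rewrite ffunE -!/(fischer cj _ _) fischer_adj.
have : fischer cj ((q \mPo f) * Delta) ((q \mPo f) * Delta) = 0.
  rewrite {2}comp_fpow [X in fischer _ _ X]mulr_suml fischer_sumr big1 // => a _.
  by rewrite -scalerAl fischerZr orthI mulr0.
by move/(fischer_eq0 posdef); rewrite qE.
Qed.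

Lemma psi_actB (s : 'M[k]_n) (u v : superpoly n k) : psi_act s (u - v) = psi_act s u - psi_act s v.
Proof. by rewrite !psi_actE sp_subst_is_additive. Qed.

Lemma psi_actZ (s : 'M[k]_n) x (u : superpoly n k) : psi_act s (x *: u) = x *: psi_act s u.
Proof.
rewrite !psi_actE sp_polyZ sp_substM; last exact: psi_frame_anticommuting.
by rewrite sp_subst_poly /= /poly_act comp_mpolyC sp_polyZ.
Qed.

Lemma basis_elt_span w : {in G, forall s, psi_act s w = \det s *: w} ->
  exists (r : seq ({set 'I_n} * 'X_{1..n})) (x : {set 'I_n} * 'X_{1..n} -> k),
    w = \sum_(t <- r) x t *: basis_elt t.
Proof.
move=> Ww; have [d hd] := fin_all_exists homog_f.
(* A constant f_i would contradict independence. Positive degrees leave only finitely many exponents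
   [a] in each degree. *)
have d_gt0 i : (0 < d i)%N.
  rewrite lt0n; apply/eqP => d0; have := hd i; rewrite d0 => /dhomogP h0.
  have fE : tnth f i = ((tnth f i)@_0%MM)%:MP.
    apply/mpolyP => m; rewrite mcoeffC; case: (eqVneq m 0%MM) => [->|nm]; first by rewrite mulr1.
    rewrite mulr0; apply: memN_msupp_eq0; apply: contra nm => /h0 /= /eqP.
    by rewrite mdeg_eq0.
  have /indep_f/(congr1 (mcoeff U_(i))) : ('X_i - ((tnth f i)@_0%MM)%:MP) \mPo f = 0.
    by rewrite rmorphB /= comp_mpolyXU -tnth_nth comp_mpolyC -fE subrr.
  by rewrite mcoeffB mcoeffX mcoeffC eqxx mnm1_eq0 mulr0 subr0 mcoeff0 => /eqP; rewrite oner_eq0.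
pose e i := (d i).-1.
pose eI (I : {set 'I_n}) := (\sum_(i in I) e i)%N.
pose delta (a : 'X_{1..n}) := (\sum_i d i * a i + \sum_i e i)%N.
have homog_df (I J : {set 'I_n}) : (df I) J \is (eI I).-homog.
  by apply: prod_linear_homog => i j; exact: mderiv_homog.
have homog_pow (a : 'X_{1..n}) : fpow a * Delta \is (delta a).-homog.
  apply: dhomogM; last exact: jacobian_homog.
  apply: (big_ind2 (fun (u : {mpoly k[n]}) b => u \is b.-homog)) => [|u b u' b'|i _].
  - exact: dhomog1.
  - exact: dhomogM.
  exact: dhomogMn.
pose D := (\max_J msize (w J))%N; pose B := (D + \sum_i e i)%N.
pose r0 : seq ({set 'I_n} * 'X_{1..n}) :=
  [seq (x.1, bmnm x.2) | x <- enum {: {set 'I_n} * 'X_{1..n < B}}].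
(* The coordinates of [basis_elt (I, a)] are homogeneous of degree delta(a) - eI(I); being below [D]
   is stated additively, without truncated subtraction. *)
pose low (t : {set 'I_n} * 'X_{1..n}) := (delta t.2 < D + eI t.1)%N.
have r0P t : low t -> t \in r0.
  case: t => I a; rewrite /low /= => lt.
  have leeI : (eI I <= \sum_i e i)%N.
    by rewrite /eI big_mkcond; apply: leq_sum => i _; case: ifP.
  have ltB : (mdeg a < B)%N.
    apply: leq_trans (leq_trans lt _); last by rewrite leq_add2l.
    rewrite ltnS (leq_trans _ (leq_addr _ _)) // mdegE; apply: leq_sum => i _.
    by rewrite leq_pmull.
  by apply/mapP; exists (I, BMultinom ltB); rewrite ?mem_enum.
have ur0 : uniq r0.
  rewrite map_inj_uniq ?enum_uniq // => -[I a] [J b] /= [-> ab].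
  by congr (_, _); apply: val_inj.
pose r := filter low r0.
have [x orth] := orthogonal_residue cjK posdef basis_elt w (filter_uniq low ur0).
exists r, x; apply/eqP; rewrite -subr_eq0; apply/eqP; set w' := _ - _ in orth *.
apply: basis_elt_orthogonal.
  move=> s sG; rewrite psi_actB Ww // scalerBr scaler_sumr; congr (_ - _).
  rewrite psi_actE sp_subst_sum; apply: eq_bigr => t _.
  by rewrite -psi_actE psi_actZ basis_elt_act // !scalerA mulrC.
have elt_coef t J m : (mdeg m + eI t.1)%N != delta t.2 -> (basis_elt t J)@_m = 0.
  by move=> ne; rewrite ffunE (diff_op_homog_coef _ (homog_df _ _) (homog_pow _) ne).
have w'_low J m : (D <= mdeg m)%N -> (w' J)@_m = 0.
  move=> leD; rewrite /w' ffunE [X in _ + X]ffunE mcoeffB memN_msupp_eq0 ?sub0r; last first.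
    by apply: msize_mdeg_ge; apply: leq_trans leD; exact: leq_bigmax.
  rewrite sum_ffunE raddf_sum big_seq big1 ?oppr0 // => t.
  rewrite mem_filter => /andP[lowt _] /=; rewrite ffunE mcoeffZ elt_coef ?mulr0 //.
  by rewrite neq_ltn (leq_trans lowt) ?orbT // leq_add2r.
(* Members that are not low are orthogonal to [w'] for degree reasons: their monomials have degree
   at least [D], those of [w'] less than [D]. *)
move=> t; case: (boolP (low t)) => [lowt|hight].
  by apply: orth; rewrite mem_filter lowt r0P.
rewrite /sp_fischer big1 // => J _.
rewrite (fischerE _ _ (leqnn _)) big1 // => m _.
have [ltD|leD] := ltnP (mdeg m) D; last by rewrite w'_low // mulr0 mul0rn.
rewrite elt_coef ?rmorph0 ?mul0r ?mul0rn // neq_ltn.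
by rewrite (leq_trans _ (_ : D + eI t.1 <= _)%N) ?ltn_add2r // leqNgt.
Qed.

End Basis.

(** * Conjugation and unitarity over the subfield *)

Section SubfieldConj.
Variables (C : numClosedFieldType) (K : divringClosed C).
Hypothesis Kconj : {in K, forall z, z^* \in K}.
Local Notation cj := (subfield_conj Kconj).

Fact subfield_conj_is_zmod_morphism : zmod_morphism cj.
Proof. by move=> x y; apply: val_inj; rewrite /= !rmorphB. Qed.

HB.instance Definition _ := GRing.isZmodMorphism.Build (subfield K) (subfield K) cj
  subfield_conj_is_zmod_morphism.

Fact subfield_conj_is_monoid_morphism : monoid_morphism cj.
Proof. by split=> [|x y]; apply: val_inj; rewrite /= ?rmorph1 ?rmorphM. Qed.

HB.instance Definition _ := GRing.isMonoidMorphism.Build (subfield K) (subfield K) cj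
  subfield_conj_is_monoid_morphism.

Lemma subfield_conjK : involutive cj.
Proof. by move=> x; apply: val_inj; rewrite /= conjCK. Qed.

Lemma subfield_conj_posdef (T : finType) (x : T -> subfield K) (c : T -> nat) :
  (forall t, 0 < c t)%N -> \sum_t cj (x t) * x t *+ c t = 0 -> forall t, x t = 0.
Proof.
move=> c_gt0 /(congr1 val); rewrite rmorph_sum rmorph0.
under eq_bigr => t _ do rewrite rmorphMn rmorphM /= mulrC -normCK.
move/eqP; rewrite psumr_eq0 => [/allP x0 t|t _]; last by rewrite mulrn_wge0 // exprn_ge0.
have := x0 t (mem_index_enum t); rewrite /= mulrn_eq0 (gtn_eqF (c_gt0 t)) /=.
by rewrite expf_eq0 normr_eq0 /= => /eqP xt; apply: val_inj; rewrite [RHS]rmorph0.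
Qed.

Lemma unitary_conj n (s : 'M[subfield K]_n) (i j : 'I_n) :
  map_mx val s \is unitarymx -> cj (invmx s i j) = s j i.
Proof.
move=> Us; apply: val_inj => /=.
have -> : val (invmx s i j) = (invmx (map_mx val s)) i j by rewrite -map_invmx mxE.
by rewrite invmx_unitary // !mxE conjCK.
Qed.

End SubfieldConj.

Lemma subgroupGL_matrix_group n (k : fieldType) (G : {fset 'M[k]_n}) :
  subgroupGL (mem G) -> matrix_group (enum_fset G).
Proof. by case=> uG G1 GM _; split=> //; exact: fset_uniq. Qed.

Theorem theorem1p3 (R : realType) (K : divringClosed R[i])
    (Kconj : {in K, forall z, z^* \in K})
    (n : nat) (G : {fset 'M[subfield K]_n})
    (reflG : complex_reflection_group G)
    (unitaryG : {in G, forall s, map_mx val s \is unitarymx})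
    (f : n.-tuple {mpoly (subfield K)[n]})
    (fundf : fundamental_invariants G f)
    (Delta : {mpoly (subfield K)[n]})
    (vandDelta : vandermonde f Delta) :
  basis_family (det_isotypic G)
    (fun Ia : {set 'I_n} * 'X_{1..n} =>
       odot (subfield_conj Kconj)
         (\prod_(i in Ia.1) sp_d (sp_poly (tnth f i)))
         (sp_poly (\prod_(i < n) tnth f i ^+ Ia.2 i * Delta))).
Proof.
have [GL _] := reflG; have gG := subgroupGL_matrix_group GL.
have [homog_f indep_f inv_f] := fundf.
have charC m : m.+1%:R != 0 :> R[i] by rewrite pnatr_eq0.
pose cj : {rmorphism subfield K -> subfield K} :=
  GRing.RMorphism.clone _ _ (subfield_conj Kconj) _.
pose iota : {rmorphism subfield K -> R[i]} := GRing.RMorphism.clone _ _ val _.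
have cjK : involutive cj by exact: subfield_conjK.
have posdef := @subfield_conj_posdef _ _ Kconj.
have unitary_s : {in G, forall s, forall i j, cj (invmx s i j) = s j i}.
  by move=> s sG i j; apply: unitary_conj; exact: unitaryG.
(* The defining equation of the Vandermonde is read at its top coordinate. *)
have DeltaE : Delta = jacobian f.
  have := congr1 (fun u : superpoly n (subfield K) => u setT) vandDelta.
  rewrite sp_polyM prod_gen_top mulr1 => <-.
  rewrite (eq_bigr _ (fun i _ => sp_d_poly (tnth f i))).
  exact: prod_linear_top.
have eltE (Ia : {set 'I_n} * 'X_{1..n}) : odot (subfield_conj Kconj)
    (\prod_(i in Ia.1) sp_d (sp_poly (tnth f i)))
    (sp_poly (\prod_(i < n) tnth f i ^+ Ia.2 i * Delta)) = basis_elt cj f Ia.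
  rewrite (odot_poly cj) DeltaE; apply/ffunP => J; rewrite !ffunE.
  by under eq_bigr => i _ do rewrite sp_d_poly.
split=> [t s sG|r x ur|w Ww].
- rewrite eltE.
  by apply: (basis_elt_act gG).
- under eq_bigr => t _ do rewrite eltE.
  by apply: (basis_elt_free iota charC _ gG).
have [r [x ->]] := basis_elt_span iota charC cjK posdef gG unitary_s homog_f indep_f inv_f Ww.
by exists r, x; apply: eq_bigr => t _; rewrite eltE.
Qed.
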